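(* Let $X$ be a metric space with bounded geometry, and $p \in \{0\}\cup[1,\infty]$. If $p\in (1,\infty)$, assume in addition that $X$ has Property A. Let $E$ be a Banach space and $B \subseteq \mathfrak{B}(\ell^p_E(X))$ a Banach subalgebra such that $C_b(X)BC_b(X)=B$ and $B$ is closed under block cutdowns. Let $a \in \mathrm{Roe}(X,B)$. Then for any $b \in B$ such that $\mathrm{Id}-ab\in\mathcal{K}(X,B)$ and $\mathrm{Id}-ba\in\mathcal{K}(X,B)$, we have $b\in\mathrm{Roe}(X,B)$. In particular, if $B$ is closed under taking inverses, then so is $\mathrm{Roe}(X,B)$.
   Context: Bounded geometry: for every $R\ge 0$, $\sup_{x\in X}\sharp B(x,R)<\infty$, where $B(x,R)$ is the closed ball and $\sharp$ denotes cardinality. Spaces: for $p\in[1,\infty)$, $\ell^p_E(X)=\ell^p(X;E)$ is the Banach space of $p$-summable functions $X\to E$ (counting measure); $\ell^\infty_E(X)$ is the Banach space of bounded functions $X\to E$; $\ell^0_E(X)=c_0(X;E)$ is the Banach space of (continuous) functions $X\to E$ vanishing at infinity, with sup-norm. $\mathfrak{B}(\cdot)$ denotes bounded linear operators, $\mathrm{Id}$ the identity operator. $C_b(X)$ is the C*-algebra of bounded continuous (complex-valued) functions on $X$ with sup-norm (equal to $\ell^\infty(X)$ here), $C_0(X)$ its subalgebra of functions vanishing at infinity; they act on $\ell^p_E(X)$ by point-wise multiplication. Block cutdowns: a net $(a_i)$ in $\mathfrak{B}(\ell^\infty_E(X))$ converges point-wise strongly to $a$ if for each $v\in\ell^\infty_E(X)$,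 $(a_iv)(x)\to(av)(x)$ for every $x\in X$. For a family $(e_j)_{j\in J}$ of positive contractions in $C_b(X)$ with pairwise disjoint supports, the block cutdown map is $\theta_{(e_j)_{j\in J}}(a)=\sum_{j\in J}e_jae_j$, which converges in the strong operator topology if $p\in\{0\}\cup[1,\infty)$ and point-wise strongly if $p=\infty$. A subalgebra $B$ is closed under block cutdowns if $\theta_{(e_j)}(a)\in B$ for every $a\in B$ and every such family. An operator $a$ has finite propagation if there is $R\ge0$ with $faf'=0$ whenever $f,f'\in C_b(X)$ with $d(\mathrm{supp}(f),\mathrm{supp}(f'))>R$. $\mathrm{Roe}(X,B)$ is the norm-closure of the set of all operators in $B$ with finite propagation. $\mathcal{K}(X,B)$ is the norm-closure of $C_0(X)BC_0(X)$ in $\mathfrak{B}(\ell^p_E(X))$. A subalgebra $A\subseteq\mathfrak{B}(\ell^p_E(X))$ is closed under taking inverses if whenever $a\in A$ is invertible in $\mathfrak{B}(\ell^p_E(X))$, then $a^{-1}\in A$. Property A: for $p\in[1,\infty)$, a metric $p$-partition of unity on $X$ is a collection $\{\phi_i:X\to[0,1]\}_{i\in I}$ such that $\{\mathrm{supp}(\phi_i)\}_{i\in I}$ is uniformly bounded ($\sup_i\mathrm{diam}(\mathrm{supp}(\phi_i))<\infty$) and of finite multiplicity (some $M$ such that each $x\in X$ lies in at most $M$ of the supports), and $\sum_{i}\phi_i(x)^p=1$ for every $x$. It has $(r,\varepsilon)$-variation if $\sum_{i}|\phi_i(x)-\phi_i(y)|^p<\varepsilon^p$ whenever $d(x,y)\le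 r$. $X$ has Property A if for any $r,\varepsilon>0$ there exists a metric $p$-partition of unity with $(r,\varepsilon)$-variation (this is independent of $p\in[1,\infty)$). *)

(* Defs.v *)
From HB Require Import structures.
From mathcomp Require Import all_boot all_order all_algebra.
From mathcomp Require Import finmap.
From mathcomp Require Import all_classical all_reals all_analysis.
From mathcomp Require Import complex.
From mathcomp Require summability.

Set Implicit Arguments.
Unset Strict Implicit.
Unset Printing Implicit Defensive.

Import Order.TTheory GRing.Theory Num.Theory.
Import numFieldNormedType.Exports.

Local Open Scope classical_set_scope.
Local Open Scope ring_scope.
Local Open Scope complex_scope.

(* MathComp norms over the scalar field R[i] take values in R[i] (in its
   nonnegative reals); [rnorm] is the same number in R. *)
Definition rnorm (R : realType) (V : normedModType R[i]) (v : V) : R :=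
  complex.Re `|v|.

Section RealNorm.
Context {R : realType} {V : normedModType R[i]}.
Implicit Types u v : V.

Lemma rnormE v : `|v| = (rnorm v)%:C.
Proof.
have := normr_ge0 v; rewrite lecE /= => /andP[/eqP im0 _].
by rewrite /rnorm; case: `|v| im0 => a b /= ->.
Qed.

Lemma rnorm_ge0 v : 0 <= rnorm v.
Proof. by have := normr_ge0 v; rewrite rnormE (ler0c). Qed.

Lemma rnormD u v : rnorm (u + v) <= rnorm u + rnorm v.
Proof. by have := ler_normD u v; rewrite !rnormE -rmorphD /= lecR. Qed.

Lemma rnormZ (k : R[i]) v : rnorm (k *: v) = rnorm (k : R[i]^o) * rnorm v.
Proof.
apply: (@complexI R); rewrite rmorphM /= -!rnormE normrZ.
by [].
Qed.

Lemma rnormN v : rnorm (- v) = rnorm v.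
Proof. by rewrite /rnorm normrN. Qed.

Lemma rnorm0 : rnorm (0 : V) = 0.
Proof. by rewrite /rnorm normr0. Qed.

Lemma rnorm0_eq0 v : rnorm v = 0 -> v = 0.
Proof. by move=> v0; apply: normr0_eq0; rewrite rnormE v0. Qed.

End RealNorm.

Inductive exponent (R : realType) : Type :=
  | exp_c0
  | exp_fin (q : R) of 1 <= q
  | exp_infty.
Arguments exp_c0 {R}.
Arguments exp_infty {R}.

Definition exponent_val (R : realType) (p : exponent R) : \bar R :=
  match p with exp_c0 => 0%:E | exp_fin q _ => q%:E | exp_infty => +oo%E end.
Coercion exponent_val : exponent >-> extended.

Definition vanishing_at_infinity (R : realType) (X : metricType R)
    (V : normedModType R[i]) (f : X -> V) :=
  forall eps : R, 0 < eps ->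
    exists2 K : set X, compact K & forall x, ~ K x -> rnorm (f x) < eps.

Section LpPredicate.
Context {R : realType} {X : metricType R} {V : normedModType R[i]}.
Implicit Types (p : exponent R) (f g : X -> V) (c : R).

Definition lp_mem p f : Prop :=
  match p with
  | exp_c0 => continuous f /\ vanishing_at_infinity f
  | exp_fin q _ => (\esum_(x in [set: X]) (rnorm (f x) `^ q)%:E < +oo)%E
  | exp_infty => bounded_fun f
  end.

Definition lp_norm p f : R :=
  match p with
  | exp_fin q _ => fine (\esum_(x in [set: X]) (rnorm (f x) `^ q)%:E) `^ q^-1
  | _ => sup (range (fun x => rnorm (f x)))
  end.

Let lp_le p c f : Prop :=
  match p with
  | exp_fin q _ => (\esum_(x in [set: X]) (rnorm (f x) `^ q)%:E <= (c `^ q)%:E)%E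
  | _ => forall x, rnorm (f x) <= c
  end.

Lemma bounded_rnormP f :
  bounded_fun f <-> exists M : R, forall x, rnorm (f x) <= M.
Proof.
split=> [[M [Mr Mf]]|[M Mf]].
  have /complex_realP[m mE] := Mr.
  exists (m + 1) => x; have := Mf (m + 1)%:C.
  rewrite mE ltcR ltrDl ltr01 => /(_ isT x I) /=.
  by rewrite rnormE lecR.
exists M%:C; split; first by apply/complex_realP; exists M.
move=> y My x _ /=; apply: le_trans (ltW My).
by rewrite rnormE lecR.
Qed.

Lemma c0_bounded f : continuous f -> vanishing_at_infinity f -> bounded_fun f.
Proof.
move=> fc /(_ 1 ltr01)[K Kc Kf]; apply/bounded_rnormP.
have : exists M : R, forall x, K x -> rnorm (f x) <= M.
  have /compact_near_coveringP Kn := Kc.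
  have [|M [Mr MK]] :=
    Kn R +oo%R (fun M x => rnorm (f x) <= M) _.
    move=> x Kx.
    have fx := @cvgr_dist_lt _ _ _ _ _ f (f x) (fc x) 1%:C.
    have /fx N : (0 : R[i]) < 1%:C by rewrite ltcR ltr01.
    exists ([set y | `|f x - f y| < 1%:C], [set M | rnorm (f x) + 1 <= M]).
      split => //=; exists (rnorm (f x) + 1); split; first exact: num_real.
      by move=> ? /ltW.
    move=> [y M] /= [].
    rewrite rnormE ltcR => fxy /(le_trans _); apply.
    rewrite -[f y](subrK (f x)) addrC (le_trans (rnormD _ _))//.
    by rewrite lerD2l -opprB rnormN ltW.
  by exists (M + 1) => x Kx; apply: (MK (M + 1) _ x) => //; rewrite ltrDl.
move=> [M MK]; exists (Num.max M 1) => x.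
have [/MK Kx|/Kf /ltW Kx] := pselect (K x).
  by rewrite le_max Kx.
by rewrite le_max Kx orbT.
Qed.

Let lp_bounded p f : lp_mem p f -> (if p is exp_fin _ _ then False else True) ->
  exists M : R, forall x, rnorm (f x) <= M.
Proof.
by case: p => [[? ?] _|//|? _]; apply/bounded_rnormP => //; apply: c0_bounded.
Qed.

Let esumZ (c : R) (a : X -> R) : 0 <= c -> (forall x, 0 <= a x) ->
  (\esum_(x in [set: X]) (c * a x)%:E <= c%:E * \esum_(x in [set: X]) (a x)%:E)%E.
Proof.
move=> c0 a0; apply: ge_ereal_sup => _ [A [finA AT] <-].
under eq_fsbigr do rewrite EFinM.
rewrite -ge0_mule_fsumr; last by move=> x; rewrite lee_fin.
apply: lee_pmul => //; first by rewrite fsume_ge0// => x; rewrite lee_fin.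
by apply: ereal_sup_ubound; exists A.
Qed.

Lemma lp_norm_ge0 p f : 0 <= lp_norm p f.
Proof.
have sup0 : 0 <= sup (range (fun x => rnorm (f x))).
  have [hs|/sup_out-> //] := pselect (has_sup (range (fun x => rnorm (f x)))).
  have [[_ [x _ _]] ub] := hs.
  by apply: (le_trans (rnorm_ge0 (f x))); apply: ub_le_sup => //; exists x.
case: p => [|q q1|] //=; exact: powR_ge0.
Qed.

Let esum_ge0' q f : (0 <= \esum_(x in [set: X]) (rnorm (f x) `^ q)%:E)%E.
Proof. by apply: esum_ge0 => x _; rewrite lee_fin powR_ge0. Qed.

Let lp_normP p f c : lp_mem p f -> 0 <= c -> lp_norm p f <= c <-> lp_le p c f.
Proof.
move=> fp c0.
have supP : (exists M : R, forall x, rnorm (f x) <= M) ->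
   sup (range (fun x => rnorm (f x))) <= c <-> forall x, rnorm (f x) <= c.
  move=> [M fM]; split=> [h x|h].
    apply: le_trans h; apply: ub_le_sup; last by exists x.
    by exists M => _ [y _ <-].
  have [[x _]|] := pselect ([set: X] !=set0).
    apply: ge_sup; first by exists (rnorm (f x)); exists x.
    by move=> _ [y _ <-].
  move=> X0; suff -> : range (fun x => rnorm (f x)) = set0 by rewrite sup0.
  by rewrite -subset0 => y [x _ _]; apply: X0; exists x.
case: p fp => [fp|q q1 /= fp|fp] /=.
- exact/supP/(lp_bounded fp).
- have q0 : 0 < q by exact: lt_le_trans q1.
  have sE : (\esum_(x in [set: X]) (rnorm (f x) `^ q)%:E)%E =
     (fine (\esum_(x in [set: X]) (rnorm (f x) `^ q)%:E))%:E.
    by rewrite fineK// ge0_fin_numE.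
  move: (esum_ge0' q f); rewrite sE lee_fin /=; set s := fine _ => s0.
  rewrite lee_fin; split => h.
    have -> : s = (s `^ q^-1) `^ q.
      by rewrite -powRrM mulVf ?gt_eqF// powRr1.
    by apply: ge0_ler_powR => //; rewrite ?nnegrE ?powR_ge0// ltW.
  have -> : c = (c `^ q) `^ q^-1.
    by rewrite -powRrM mulfV ?gt_eqF// powRr1.
  by apply: ge0_ler_powR => //; rewrite ?nnegrE ?powR_ge0 ?invr_ge0// ltW.
- exact/supP/(lp_bounded fp).
Qed.

Let lp_leD p (a b : R) f g : 0 < a -> 0 < b -> lp_le p a f -> lp_le p b g ->
  lp_le p (a + b) (f \+ g).
Proof.
move=> a0 b0.
case: p => [|q q1|] /=; try
  by move=> fa gb x; rewrite (le_trans (rnormD _ _))// lerD.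
move=> fa gb; have q0 : 0 < q by exact: lt_le_trans q1.
have ab0 : 0 < a + b by exact: addr_gt0.
pose t : R := a / (a + b); pose u : R := b / (a + b).
have t0 : 0 <= t by rewrite /t divr_ge0 ?(ltW a0) ?(ltW ab0).
have u0 : 0 <= u by rewrite /u divr_ge0 ?(ltW b0) ?(ltW ab0).
have tu : t + u = 1 by rewrite /t /u -mulrDl mulfV ?gt_eqF.
have at_ : (a + b) * t = a by rewrite /t mulrC divfK ?gt_eqF.
have bu : (a + b) * u = b by rewrite /u mulrC divfK ?gt_eqF.
clearbody t u.
pose A := (a + b) `^ q * (t * a^-1 `^ q).
pose B := (a + b) `^ q * (u * b^-1 `^ q).
have A0 : 0 <= A by rewrite /A; do 2!(apply: mulr_ge0; rewrite ?powR_ge0//).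
have B0 : 0 <= B by rewrite /B; do 2!(apply: mulr_ge0; rewrite ?powR_ge0//).
have key x :
    rnorm (f x + g x) `^ q <= A * rnorm (f x) `^ q + B * rnorm (g x) `^ q.
  have F0 := rnorm_ge0 (f x); have G0 := rnorm_ge0 (g x).
  have Fa : 0 <= a^-1 * rnorm (f x) by rewrite mulr_ge0 ?invr_ge0 ?(ltW a0) ?(ltW b0).
  have Gb : 0 <= b^-1 * rnorm (g x) by rewrite mulr_ge0 ?invr_ge0 ?(ltW a0) ?(ltW b0).
  have t1 : t <= 1 by rewrite -tu lerDl.
  have /= := @convex_powR R q q1 (Itv01 t0 t1)
     (a^-1 * rnorm (f x)) (b^-1 * rnorm (g x)).
  rewrite !inE /= !in_itv /= !andbT => /(_ Fa Gb).
  rewrite [X in X `^ _ <= _ -> _]convRE [X in _ <= X -> _]convRE /=.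
  rewrite /unstable.onem.
  rewrite (_ : 1 - t = u); last by rewrite -tu addrC addKr.
  move=> h.
  have -> : A * rnorm (f x) `^ q + B * rnorm (g x) `^ q =
    (a + b) `^ q * (t * (a^-1 * rnorm (f x)) `^ q +
                    u * (b^-1 * rnorm (g x)) `^ q).
    by rewrite !powRM ?invr_ge0 ?(ltW a0) ?(ltW b0)// mulrDr /A /B !mulrA.
  apply: le_trans (ler_wpM2l (powR_ge0 _ _) h).
  have w0 : 0 <= t * (a^-1 * rnorm (f x)) + u * (b^-1 * rnorm (g x)).
    by rewrite addr_ge0// mulr_ge0.
  rewrite -powRM// ?(ltW ab0)//.
  apply: ge0_ler_powR; rewrite ?nnegrE ?rnorm_ge0 ?(ltW q0)//.
    by rewrite mulr_ge0// ltW.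
  by rewrite mulrDr !mulrA at_ bu !mulfV ?gt_eqF// !mul1r rnormD.
apply: (@le_trans _ _ (\esum_(x in [set: X])
    ((A * rnorm (f x) `^ q)%:E + (B * rnorm (g x) `^ q)%:E))%E).
  by apply: le_esum => x _; rewrite -EFinD lee_fin key.
rewrite esumD; last 2 first.
- by move=> x _; rewrite lee_fin mulr_ge0 ?powR_ge0.
- by move=> x _; rewrite lee_fin mulr_ge0 ?powR_ge0.
apply: le_trans (leeD (esumZ A0 _) (esumZ B0 _)) _ => //.
- by move=> x; rewrite powR_ge0.
- by move=> x; rewrite powR_ge0.
apply: le_trans (leeD (lee_wpmul2l _ fa) (lee_wpmul2l _ gb)) _ => //.
rewrite -!EFinM -EFinD lee_fin /A /B -!mulrA -!powRM ?invr_ge0 ?(ltW a0) ?(ltW b0)//.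
by rewrite !mulVf ?gt_eqF// !powR1 !mulr1 -mulrDr tu mulr1.
Qed.

Let lp_leZ p c k f : 0 <= c -> lp_le p c f ->
  lp_le p (rnorm (k : R[i]^o) * c) (k \*: f).
Proof.
have k0 := rnorm_ge0 (k : R[i]^o).
case: p => [|q q1|] /=; try
  by move=> c0 fc x; rewrite rnormZ ler_wpM2l.
move=> c0 fc; rewrite powRM// EFinM.
apply: le_trans (lee_wpmul2l _ fc); last by rewrite lee_fin powR_ge0.
under eq_esum do rewrite rnormZ powRM ?rnorm_ge0//.
by apply: esumZ => [|x]; exact: powR_ge0.
Qed.

Let lp_le_fin p f : lp_mem p f -> lp_le p (lp_norm p f) f.
Proof. by move=> fp; apply/(lp_normP fp) => //; exact: lp_norm_ge0. Qed.

Let lp_leW p c c' f : 0 <= c -> c <= c' -> lp_le p c f -> lp_le p c' f.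
Proof.
move=> c0 cc'; case: p => [|q q1|] /=; try
  by move=> fc x; rewrite (le_trans (fc x)).
move=> fc; rewrite (le_trans fc)// lee_fin.
apply: ge0_ler_powR; rewrite ?nnegrE ?(le_trans c0 cc')//.
exact: le_trans q1.
Qed.

Lemma vanishing_at_infinityD f g : vanishing_at_infinity f ->
  vanishing_at_infinity g -> vanishing_at_infinity (f \+ g).
Proof.
move=> fv gv eps eps0; have e2 : 0 < eps / 2 by rewrite divr_gt0.
have [K Kc Kf] := fv _ e2; have [L Lc Lg] := gv _ e2.
exists (K `|` L); first exact: compactU.
move=> x /not_orP[Kx Lx]; rewrite (le_lt_trans (rnormD _ _))//.
by rewrite [eps]splitr ltrD ?Kf ?Lg.
Qed.

Lemma vanishing_at_infinityZ k f :
  vanishing_at_infinity f -> vanishing_at_infinity (k \*: f).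
Proof.
move=> fv eps eps0; have k0 := rnorm_ge0 (k : R[i]^o).
have k1 : 0 < rnorm (k : R[i]^o) + 1 by rewrite ltr_wpDl.
have [|K Kc Kf] := fv (eps / (rnorm (k : R[i]^o) + 1)).
  by rewrite divr_gt0.
exists K => // x /Kf; rewrite ltr_pdivlMr// rnormZ mulrC.
by apply: le_lt_trans; rewrite ler_wpM2r ?rnorm_ge0 ?lerDl.
Qed.

Let lp_mem0 p : lp_mem p (fun=> 0).
Proof.
case: p => [|q q1|] /=.
- split; first by move=> x; exact: cvg_cst.
  by move=> e e0; exists set0; [exact: compact0|move=> x _; rewrite rnorm0].
- rewrite esum1// => x _.
  by rewrite rnorm0 powR0// gt_eqF// (lt_le_trans _ q1).
- by apply/bounded_rnormP; exists 0 => x; rewrite rnorm0.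
Qed.

Let lp_leP p c f : (if p is exp_c0 then lp_mem p f else True) ->
  lp_le p c f -> lp_mem p f.
Proof.
case: p => [|q q1|] //= _ fc; first by rewrite (le_lt_trans fc)// ltry.
by apply/bounded_rnormP; exists c.
Qed.

Let lp_memD p f g : lp_mem p f -> lp_mem p g -> lp_mem p (f \+ g).
Proof.
move=> fp gp; have f1 : 0 < lp_norm p f + 1 by rewrite ltr_wpDl ?lp_norm_ge0.
have g1 : 0 < lp_norm p g + 1 by rewrite ltr_wpDl ?lp_norm_ge0.
apply: (lp_leP _ (lp_leD f1 g1 _ _)).
- case: p fp gp f1 g1 => //= -[fc fv] [gc gv] _ _; split.
    by move=> x; apply: cvgD; [exact: fc|exact: gc].
  exact: vanishing_at_infinityD.
- by apply: lp_leW (lp_le_fin fp); rewrite ?lp_norm_ge0 ?lerDl.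
- by apply: lp_leW (lp_le_fin gp); rewrite ?lp_norm_ge0 ?lerDl.
Qed.

Let lp_memZ p k f : lp_mem p f -> lp_mem p (k \*: f).
Proof.
move=> fp; apply: (lp_leP _ (lp_leZ k _ (lp_le_fin fp))); last first.
  exact: lp_norm_ge0.
case: p fp => //= -[fc fv]; split.
  by move=> x; apply: cvgZr; exact: fc.
exact: vanishing_at_infinityZ.
Qed.

Lemma lp_submod_closed p : submod_closed [pred f : X -> V | `[< lp_mem p f >]].
Proof.
split=> [|k f g]; first by apply/asboolP/lp_mem0.
move=> /asboolP fp /asboolP gp; apply/asboolP.
by apply: lp_memD => //; exact: lp_memZ.
Qed.

Lemma ler_lp_normD p f g : lp_mem p f -> lp_mem p g ->
  lp_norm p (f \+ g) <= lp_norm p f + lp_norm p g.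
Proof.
move=> fp gp; apply/ler_addgt0Pr => e e0.
have e2 : 0 < e / 2 by rewrite divr_gt0.
have f0 := lp_norm_ge0 p f; have g0 := lp_norm_ge0 p g.
have -> : lp_norm p f + lp_norm p g + e =
          (lp_norm p f + e / 2) + (lp_norm p g + e / 2).
  by rewrite addrACA -splitr.
apply/lp_normP; [exact: lp_memD|by do !apply: addr_ge0 => //; exact: ltW|].
apply: lp_leD; rewrite ?ltr_wpDl//.
- by apply: lp_leW (lp_le_fin fp); rewrite ?lp_norm_ge0 ?lerDl ?(ltW e2).
- by apply: lp_leW (lp_le_fin gp); rewrite ?lp_norm_ge0 ?lerDl ?(ltW e2).
Qed.

Let ler_lp_normZ p k f : lp_mem p f ->
  lp_norm p (k \*: f) <= rnorm (k : R[i]^o) * lp_norm p f.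
Proof.
move=> fp; apply/lp_normP; first exact: lp_memZ.
  by rewrite mulr_ge0 ?rnorm_ge0 ?lp_norm_ge0.
by apply: lp_leZ; [exact: lp_norm_ge0|exact: lp_le_fin].
Qed.

Lemma lp_normZ p k f : lp_mem p f ->
  lp_norm p (k \*: f) = rnorm (k : R[i]^o) * lp_norm p f.
Proof.
move=> fp; apply/eqP; rewrite eq_le ler_lp_normZ//=.
have [->|k0] := eqVneq k 0.
  by rewrite rnorm0 mul0r lp_norm_ge0.
have kN : rnorm (k^-1 : R[i]^o) = (rnorm (k : R[i]^o))^-1.
  apply: (@complexI R); rewrite fmorphV /= -!rnormE.
  by rewrite -[LHS]/(`|k^-1 : R[i]|) normfV.
have k1 : 0 < rnorm (k : R[i]^o).
  rewrite lt_neqAle rnorm_ge0 andbT; apply: contra k0 => /eqP/esym.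
  by move/(@rnorm0_eq0 _ R[i]^o) => ->.
rewrite -ler_pdivlMl// -kN.
have {1}-> : f = k^-1 \*: (k \*: f).
  by apply/funext => x /=; rewrite scalerA mulVf// scale1r.
by apply: ler_lp_normZ; exact: lp_memZ.
Qed.

Lemma rnorm_le_lp p f x : lp_mem p f -> rnorm (f x) <= lp_norm p f.
Proof.
move=> fp; have := lp_le_fin fp; have N0 := lp_norm_ge0 p f.
move: N0; move: (lp_norm p f) => N N0.
case: p fp => [|q q1|] /= _; [by apply| |by apply].
move=> h.
have q0 : 0 < q by exact: lt_le_trans q1.
have fxN : ((rnorm (f x) `^ q)%:E <= (N `^ q)%:E)%E.
  apply: le_trans h; apply: esum_ge; exists [set x]; first by split.
  by rewrite fsbig_set1.
rewrite lee_fin in fxN; rewrite leNgt; apply/negP => Nf; move: fxN.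
by rewrite leNgt gt0_ltr_powR// nnegrE rnorm_ge0.
Qed.

Lemma lp_mem_le p f g c : 0 <= c -> (forall x, rnorm (g x) <= c * rnorm (f x)) ->
  (p = exp_c0 -> continuous g) -> lp_mem p f ->
  lp_mem p g /\ lp_norm p g <= c * lp_norm p f.
Proof.
move=> c0 gf gc fp; have cf0 : 0 <= c * lp_norm p f.
  by rewrite mulr_ge0 ?lp_norm_ge0.
have gle : lp_le p (c * lp_norm p f) g.
  have := lp_le_fin fp; have := lp_norm_ge0 p f.
  move: (lp_norm p f) => N N0; case: p {gc fp cf0} => [|q q1|] /=; try
    by move=> h x; rewrite (le_trans (gf x))// ler_wpM2l.
  move=> h; rewrite powRM// EFinM.
  apply: le_trans (lee_wpmul2l _ h); last by rewrite lee_fin powR_ge0.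
  apply: le_trans (esumZ (powR_ge0 c q) _) => [|x]; last exact: powR_ge0.
  apply: le_esum => x _; rewrite lee_fin -powRM ?rnorm_ge0//.
  apply: ge0_ler_powR; rewrite ?nnegrE ?rnorm_ge0 ?mulr_ge0 ?rnorm_ge0//.
  exact: le_trans q1.
have gp : lp_mem p g.
  apply: (lp_leP _ gle); case: p fp gc {cf0 gle} => //= -[fc fv] /(_ erefl) gc.
  split=> // eps eps0; have c1 : 0 < c + 1 by rewrite ltr_wpDl.
  have [|K Kc Kf] := fv (eps / (c + 1)); first by rewrite divr_gt0.
  exists K => // x /Kf; rewrite ltr_pdivlMr// mulrC => /(le_lt_trans _); apply.
  by rewrite (le_trans (gf x))// ler_wpM2r ?rnorm_ge0 ?lerDl.
by split=> //; apply/lp_normP.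
Qed.

End LpPredicate.

Section LpSpace.
Context {R : realType} {X : metricType R} {E : normedModType R[i]}.

Definition lp_pred (p : exponent R) : {pred X -> E} :=
  [pred f : X -> E | `[< lp_mem p f >]].

HB.instance Definition _ p :=
  GRing.isSubmodClosed.Build _ _ (lp_pred p) (@lp_submod_closed R X E p).

End LpSpace.

Record lp (R : realType) (X : metricType R) (E : normedModType R[i])
  (p : exponent R) := Lp { lp_fun :> X -> E; _ : lp_fun \in lp_pred p }.

Section LpNorm.
Context {R : realType} {X : metricType R} {E : normedModType R[i]}
  {p : exponent R}.
Local Notation lp := (lp X E p).
Implicit Types (f g : lp).

HB.instance Definition _ := [isSub for @lp_fun R X E p].
HB.instance Definition _ := [Choice of lp by <:].
HB.instance Definition _ := [SubChoice_isSubLmodule of lp by <:].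

Lemma lpP f : lp_mem p f.
Proof. by have /asboolP := valP f. Qed.

Let norm f : R[i] := (lp_norm p f)%:C.

Let normD f g : norm (f + g) <= norm f + norm g.
Proof. by rewrite -rmorphD /= lecR; apply: ler_lp_normD; exact: lpP. Qed.

Let normZ (k : R[i]) f : norm (k *: f) = `|k| * norm f.
Proof.
have -> : norm (k *: f) = (rnorm (k : R[i]^o) * lp_norm p f)%:C.
  by rewrite -lp_normZ//; exact: lpP.
by rewrite rmorphM /= -rnormE.
Qed.

Let norm0_eq0 f : norm f = 0 -> f = 0.
Proof.
move=> [f0]; apply/val_inj/funext => x /=.
apply: rnorm0_eq0; apply/eqP; rewrite eq_le rnorm_ge0 andbT -f0.
by apply: rnorm_le_lp; exact: lpP.
Qed.

HB.instance Definition _ := Lmodule_isNormed.Build R[i] lp normD normZ norm0_eq0.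

Lemma lp_rnormE f : rnorm f = lp_norm p f. Proof. by []. Qed.

End LpNorm.

Section BoundedOperatorPredicate.
Context {R : realType} {V : normedModType R[i]}.

Definition bop_pred : {pred V -> V} :=
  [pred a : V -> V | `[< linear a /\ continuous a >]].

Lemma bop_submod_closed : submod_closed bop_pred.
Proof.
split=> [|k a b].
  apply/asboolP; split; first by move=> l u v; rewrite /= scaler0 addr0.
  by move=> x; exact: cvg_cst.
move=> /asboolP[al ac] /asboolP[bl bc]; apply/asboolP; split.
  move=> l u v; rewrite -[LHS]/(k *: a (l *: u + v) + b (l *: u + v)).
  rewrite -[RHS]/(l *: (k *: a u + b u) + (k *: a v + b v)) al bl.
  by rewrite !scalerDr !scalerA [k * l]mulrC addrACA.
by move=> x; apply: cvgD; [apply: cvgZr; exact: ac|exact: bc].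
Qed.

HB.instance Definition _ :=
  GRing.isSubmodClosed.Build _ _ bop_pred bop_submod_closed.

End BoundedOperatorPredicate.

Record bop (R : realType) (V : normedModType R[i]) :=
  BOp { bop_fun :> V -> V; _ : bop_fun \in @bop_pred R V }.

Section BoundedOperators.
Context {R : realType} {V : normedModType R[i]}.
Local Notation bop := (bop V).
Implicit Types (a b c : bop) (v : V).

HB.instance Definition _ := [isSub for @bop_fun R V].
HB.instance Definition _ := [Choice of bop by <:].
HB.instance Definition _ := [SubChoice_isSubLmodule of bop by <:].

Lemma bop_linear a : linear a.
Proof. by have /asboolP[] := valP a. Qed.

Lemma bop_continuous a : continuous a.
Proof. by have /asboolP[] := valP a. Qed.

HB.instance Definition _ a :=
  GRing.isLinear.Build R[i] V V _ (bop_fun a) (bop_linear a).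

Lemma bopP a b : (forall v, a v = b v) -> a = b.
Proof. by move=> ab; apply/val_inj/funext. Qed.

Lemma bop_bounded a : exists M : R, forall v, rnorm (a v) <= M * rnorm v.
Proof.
have /linear_boundedP[M [Mr aM]] : bounded_near (bop_fun a) (nbhs 0).
  by apply: continuous_linear_bounded; exact: bop_continuous.
have /complex_realP[m mE] := Mr.
exists (m + 1) => v; have := aM (m + 1)%:C.
rewrite mE ltcR ltrDl ltr01 => /(_ isT v).
by rewrite !rnormE -rmorphM /= lecR.
Qed.

Lemma bop_subproof (f : V -> V) (M : R) : linear f ->
  (forall v, rnorm (f v) <= M * rnorm v) -> f \in bop_pred.
Proof.
move=> fl fM; apply/asboolP; split => //.
pose F : {linear V -> V} := HB.pack f (GRing.isLinear.Build R[i] V V _ f fl).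
apply: (@bounded_linear_continuous _ _ _ F); apply/linear_boundedP.
exists M%:C; split; first by apply/complex_realP; exists M.
move=> y My v; apply: (@le_trans _ _ (M%:C * `|v|)).
  by rewrite /= !rnormE -rmorphM /= lecR; exact: fM.
by rewrite ler_wpM2r// ltW.
Qed.

Definition bop_of_bound (f : V -> V) (M : R) (fl : linear f)
  (fM : forall v, rnorm (f v) <= M * rnorm v) : bop := BOp (bop_subproof fl fM).

Definition opnorm a : R := sup [set rnorm (a v) | v in [set v | rnorm v <= 1]].

Let opnorm_has_sup a :
  has_sup [set rnorm (a v) | v in [set v | rnorm v <= 1]].
Proof.
split; first by exists (rnorm (a 0)); exists 0 => //=; rewrite rnorm0.
have [M aM] := bop_bounded a; exists `|M| => _ [v /= v1 <-].
rewrite (le_trans (aM v))// (le_trans (ler_norm _))// normrM.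
by rewrite ler_piMr// ger0_norm// rnorm_ge0.
Qed.

Lemma opnorm_ge0 a : 0 <= opnorm a.
Proof.
have [_ ub] := opnorm_has_sup a; apply: ub_le_sup => //.
by exists 0 => /=; rewrite ?linear0 rnorm0.
Qed.

Lemma rnorm_opnorm a v : rnorm (a v) <= opnorm a * rnorm v.
Proof.
have [->|v0] := eqVneq v 0; first by rewrite linear0 !rnorm0 mulr0.
have nv : 0 < rnorm v.
  by rewrite lt_neqAle rnorm_ge0 andbT; apply: contra v0 => /eqP/esym/rnorm0_eq0->.
have kN : rnorm ((rnorm v)^-1%:C : R[i]^o) = (rnorm v)^-1.
  apply: (@complexI R); rewrite -rnormE -[LHS]/(`|((rnorm v)^-1)%:C|).
  by rewrite ger0_norm// ler0c invr_ge0 ltW.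
rewrite -ler_pdivrMr// mulrC -kN -rnormZ -linearZ.
have [_ ub] := opnorm_has_sup a; apply: ub_le_sup => //.
by exists ((rnorm v)^-1%:C *: v) => //=; rewrite rnormZ kN mulVf ?gt_eqF.
Qed.

Lemma opnorm_le a M : 0 <= M -> (forall v, rnorm (a v) <= M * rnorm v) ->
  opnorm a <= M.
Proof.
move=> M0 aM; have [ne _] := opnorm_has_sup a; apply: ge_sup => //.
by move=> _ [v /= v1 <-]; rewrite (le_trans (aM v))// ler_piMr.
Qed.

Let norm a : R[i] := (opnorm a)%:C.

Let normD a b : norm (a + b) <= norm a + norm b.
Proof.
rewrite -rmorphD /= lecR; apply: opnorm_le => [|v].
  by rewrite addr_ge0 ?opnorm_ge0.
by rewrite mulrDl (le_trans (rnormD _ _))// lerD ?rnorm_opnorm.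
Qed.

Let opnormZ_le (k : R[i]) a : opnorm (k *: a) <= rnorm (k : R[i]^o) * opnorm a.
Proof.
apply: opnorm_le => [|v]; first by rewrite mulr_ge0 ?rnorm_ge0 ?opnorm_ge0.
by rewrite /= rnormZ -mulrA ler_wpM2l ?rnorm_ge0 ?rnorm_opnorm.
Qed.

Let normZ (k : R[i]) a : norm (k *: a) = `|k| * norm a.
Proof.
have -> : `|k| = (rnorm (k : R[i]^o))%:C by rewrite -rnormE.
rewrite -rmorphM /=; congr _%:C; apply/eqP; rewrite eq_le opnormZ_le/=.
have [->|k0] := eqVneq k 0; first by rewrite rnorm0 mul0r opnorm_ge0.
have kN : rnorm (k^-1 : R[i]^o) = (rnorm (k : R[i]^o))^-1.
  apply: (@complexI R); rewrite fmorphV /= -!rnormE.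
  by rewrite -[LHS]/(`|k^-1 : R[i]|) normfV.
have k1 : 0 < rnorm (k : R[i]^o).
  rewrite lt_neqAle rnorm_ge0 andbT; apply: contra k0 => /eqP/esym.
  by move/(@rnorm0_eq0 _ R[i]^o) => ->.
rewrite -ler_pdivlMl// -kN -{1}[a](scalerK k0); exact: opnormZ_le.
Qed.

Let norm0_eq0 a : norm a = 0 -> a = 0.
Proof.
move=> [a0]; apply: bopP => v; apply: rnorm0_eq0; apply/eqP.
rewrite eq_le rnorm_ge0 andbT (le_trans (rnorm_opnorm a v))//.
by rewrite a0 mul0r.
Qed.

HB.instance Definition _ :=
  Lmodule_isNormed.Build R[i] bop normD normZ norm0_eq0.

Lemma bop_rnormE a : rnorm a = opnorm a. Proof. by []. Qed.

Let bop_comp_subproof a b : (bop_fun a \o bop_fun b) \in bop_pred.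
Proof.
apply/asboolP; split; first by move=> k u v; rewrite /= !linearP.
by move=> v; apply: continuous_comp; exact: bop_continuous.
Qed.

Definition bop_comp a b : bop := BOp (bop_comp_subproof a b).

Let bop_id_subproof : (@id V) \in bop_pred.
Proof. by apply/asboolP; split=> // v; exact: cvg_id. Qed.

Definition bop_id : bop := BOp bop_id_subproof.

Let compA : associative bop_comp. Proof. by move=> a b c; exact: bopP. Qed.
Let comp1l : left_id bop_id bop_comp. Proof. by move=> a; exact: bopP. Qed.
Let comp1r : right_id bop_id bop_comp. Proof. by move=> a; exact: bopP. Qed.
Let compDl : left_distributive bop_comp +%R.
Proof. by move=> a b c; exact: bopP. Qed.
Let compDr : right_distributive bop_comp +%R.
Proof. by move=> a b c; apply: bopP => v; rewrite /= linearD. Qed.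

(* Composition of operators; the unit is the identity operator (V may be
   trivial, so the ring is not assumed nonzero). *)
HB.instance Definition _ :=
  GRing.Zmodule_isPzRing.Build bop compA comp1l comp1r compDl compDr.

End BoundedOperators.

Section MetricGeometry.
Context {R : realType} {X : metricType R}.
Local Open Scope ereal_scope.

Definition bounded_geometry : Prop :=
  forall r : R, (0 <= r)%R ->
    exists N : nat, forall x : X, ([set y | (mdist x y <= r)%R] #<= `I_N)%card.

Definition supp (V : nmodType) (f : X -> V) : set X :=
  closure [set x | f x != 0%R].

(* +oo when A or B is empty *)
Definition set_dist (A B : set X) : \bar R :=
  ereal_inf [set (mdist x y)%:E | x in A & y in B].

(* -oo when A is empty *)
Definition diam (A : set X) : \bar R :=
  ereal_sup [set (mdist x y)%:E | x in A & y in A].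

Definition metric_partition_of_unity (q : R) (I : choiceType)
    (phi : I -> X -> R) : Prop :=
  [/\ forall i x, (0 <= phi i x <= 1)%R,
      ereal_sup [set diam (supp (phi i)) | i in [set: I]] < +oo,
      exists M : nat, forall x, ([set i | supp (phi i) x] #<= `I_M)%card
    & forall x, \esum_(i in [set: I]) (phi i x `^ q)%:E = 1].

Definition has_variation (q : R) (I : choiceType) (phi : I -> X -> R)
    (r eps : R) : Prop :=
  forall x y, (mdist x y <= r)%R ->
    \esum_(i in [set: I]) (`|phi i x - phi i y| `^ q)%:E < (eps `^ q)%:E.

(* The exponent q is immaterial; some q in [1, +oo[ is required to work for
   all r and eps. *)
Definition property_A : Prop :=
  exists2 q : R, (1 <= q)%R & forall r eps : R, (0 < r)%R -> (0 < eps)%R ->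
    exists (I : choiceType) (phi : I -> X -> R),
      metric_partition_of_unity q phi /\ has_variation q phi r eps.

End MetricGeometry.
Arguments bounded_geometry {R} X.
Arguments property_A {R} X.

Definition Cb_pred (R : realType) (X : metricType R) : {pred X -> R[i]^o} :=
  [pred f : X -> R[i]^o | `[< continuous f /\ bounded_fun f >]].

Record Cb (R : realType) (X : metricType R) :=
  BContFun { Cb_fun :> X -> R[i]^o; _ : Cb_fun \in @Cb_pred R X }.

Section ContinuousBoundedFunctions.
Context {R : realType} {X : metricType R}.

HB.instance Definition _ := [isSub for @Cb_fun R X].

Definition C0 : set (Cb X) := [set f | vanishing_at_infinity f].

Definition positive_contraction (e : Cb X) : Prop :=
  forall x, (0 : R[i]) <= e x <= 1.

Lemma Cb_continuous (f : Cb X) : continuous f.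
Proof. by have /asboolP[] := valP f. Qed.

Lemma Cb_bounded (f : Cb X) : bounded_fun f.
Proof. by have /asboolP[] := valP f. Qed.

End ContinuousBoundedFunctions.
Arguments C0 {R X}.

Section Multiplication.
Context {R : realType} {X : metricType R} {E : normedModType R[i]}
  {p : exponent R}.
Local Notation lp := (lp X E p).
Implicit Types (f : Cb X) (v : lp).

Let mul_le f : exists2 M : R, 0 <= M & forall v x, rnorm (f x *: v x) <= M * rnorm (v x).
Proof.
have /bounded_rnormP[M fM] := Cb_bounded f.
exists (Num.max 0 M); first by rewrite le_max lexx.
by move=> v x; rewrite rnormZ ler_wpM2r ?rnorm_ge0 ?le_max ?fM ?orbT.
Qed.

Let mul_cont f v : p = exp_c0 -> continuous (fun x => f x *: v x).
Proof.
move=> p0; have := lpP v; move: (v : X -> E) => {}v; rewrite p0 => -[vc _] x.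
by apply: cvgZ; [exact: Cb_continuous|exact: vc].
Qed.

Let mul_subproof f v : (fun x => f x *: v x) \in lp_pred p.
Proof.
apply/asboolP; have [M M0 fM] := mul_le f.
exact: (proj1 (lp_mem_le M0 (fM v) (@mul_cont f v) (lpP v))).
Qed.

Definition mul_fun f v : lp := Lp (mul_subproof f v).

Let mulop_subproof f : mul_fun f \in bop_pred.
Proof.
have [M M0 fM] := mul_le f; apply: (@bop_subproof _ _ _ M).
  move=> k u v; apply/val_inj/funext => x.
  rewrite -[LHS]/(f x *: (k *: u x + v x)).
  rewrite -[RHS]/(k *: (f x *: u x) + f x *: v x).
  by rewrite scalerDr !scalerA mulrC.
move=> v; exact: (proj2 (lp_mem_le M0 (fM v) (@mul_cont f v) (lpP v))).
Qed.

Definition mulop f : bop lp := BOp (mulop_subproof f).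

Lemma mulopE f v x : mulop f v x = f x *: v x. Proof. by []. Qed.

End Multiplication.

Section Roe.
Context {R : realType} {X : metricType R} {E : normedModType R[i]}
  {p : exponent R}.
Local Notation lp := (lp X E p).
Local Notation bop := (bop lp).
Implicit Types (a b t : bop) (A B : set bop).

Definition banach_subalgebra B : Prop :=
  [/\ B 0,
      forall a b, B a -> B b -> B (a + b),
      forall (k : R[i]) a, B a -> B (k *: a),
      forall a b, B a -> B b -> B (a * b)
    & closed B].

(* The set of products S B S', functions acting by multiplication *)
Definition cutdowns (S : set (Cb X)) B (S' : set (Cb X)) : set bop :=
  [set c | exists f b g, [/\ S f, B b, S' g & c = mulop f * b * mulop g]].

(* t = \sum_j e_j a e_j: the net of partial sums over finite subsets of J
   converges to t in the strong operator topology, and point-wise strongly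
   when p = +oo. Such a t is unique. *)
Definition is_block_cutdown (J : choiceType) (e : J -> Cb X) a t : Prop :=
  let S (F : {fset J}) : bop :=
    \sum_(j <- enum_fset F) mulop (e j) * a * mulop (e j) in
  match p with
  | exp_infty => forall (v : lp) (x : X),
      (fun F => S F v x) @ summability.totally --> t v x
  | _ => forall v : lp, (fun F => S F v) @ summability.totally --> t v
  end.

Definition closed_under_block_cutdowns B : Prop :=
  forall (J : choiceType) (e : J -> Cb X),
    (forall j, positive_contraction (e j)) ->
    trivIset [set: J] (fun j => supp (e j)) ->
    forall a t, B a -> is_block_cutdown e a t -> B t.

Definition finite_propagation a : Prop :=
  exists2 r : R, 0 <= r & forall f f' : Cb X,
    (r%:E < set_dist (supp f) (supp f'))%E -> mulop f * a * mulop f' = 0.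

Definition Roe B : set bop := closure (B `&` finite_propagation).

Definition Kom B : set bop := closure (cutdowns C0 B C0).

Definition inverse_closed A : Prop :=
  forall a a', A a -> a * a' = 1 -> a' * a = 1 -> A a'.

End Roe.

(* Main.v *)
Require Import Defs.
From mathcomp Require Import all_boot all_order all_algebra.
From mathcomp Require Import finmap.
From mathcomp Require Import all_classical all_reals all_analysis.
From mathcomp Require Import complex.
From mathcomp Require Import ring lra.
From mathcomp Require summability.
Set Implicit Arguments.
Unset Strict Implicit.
Unset Printing Implicit Defensive.
Import Order.TTheory GRing.Theory Num.Theory.
Import numFieldNormedType.Exports.
Local Open Scope classical_set_scope.
Local Open Scope ring_scope.
Local Open Scope complex_scope.

(** Put k = 1 - ab and k' = 1 - ba. For a function f on X and a point x0, the
    relation bk = k'b makes the constant f(x0) disappear from the identity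
      fb - bf = - b (fa - af) b - b (f - f(x0)) k + k' (f - f(x0)) b
    ([comm_inverse]). When f takes values in [0, 1] and varies slowly, the
    commutator of f with a is small because a is nearly of finite propagation,
    and the other two terms are small because k and k' are concentrated on a
    finite set, on which f is nearly constant. So b nearly commutes with every
    slowly varying f. The identity is linear in f, and the estimates persist for
    a whole family (f_i) when operators are replaced by columns (T_i) normed as
    maps from l^p(X; E) to l^p(I; l^p(X; E)), as soon as f : X -> l^p(I) varies
    slowly ([vanishing_comm_inverse]).

    From this b is approximated by band operators b' = sum_z psi_z b phi_z, where
    psi_z and phi_z are supported in the ball of radius S about z.
    - For p = 0 and p = oo, psi_z is the indicator of z and phi_z a wide tent
      with phi_z(z) = 1: at z, the function (b - b') v is the commutator of phi_z
      and b applied to v, so a sup norm bound suffices ([approx_sup]).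
    - For p = 1 the roles of psi and phi are exchanged, and the l^1 norm of an
      operator is read off its columns ([approx_l1]).
    - For 1 < p < oo Property A provides f_z >= 0 with sum_z f_z = 1 and slow
      variation in l^1. Take phi_z = f_z^(1/p) and psi_z = f_z^(1 - 1/p): then
      b - b' = sum_z psi_z (phi_z b - b phi_z), and a Hoelder type inequality
      bounds it by the column norm of the commutators ([approx_lq]).

    Such a b' lies in B: colour X with finitely many colours so that balls of
    radius S about points of one colour are disjoint ([coloring]); the part of b'
    coming from one colour is a block cutdown of b between two multipliers
    ([band_operator]). *)

(** * Unordered sums and l^p norms of families *)

Section UnorderedSums.
Context {R : realType}.
Local Open Scope ereal_scope.

Lemma esumZ (I : choiceType) (c : R) (a : I -> \bar R) :
  (0 <= c)%R -> (forall i, 0 <= a i) ->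
  \esum_(i in [set: I]) (c%:E * a i) <= c%:E * \esum_(i in [set: I]) a i.
Proof.
move=> c0 a0; apply: ge_ereal_sup => _ [A [finA AT] <-].
rewrite -ge0_mule_fsumr//; apply: lee_pmul => //.
  by rewrite fsume_ge0.
by apply: ereal_sup_ubound; exists A.
Qed.

Lemma exchange_esum (I J : choiceType) (a : I -> J -> \bar R) :
  (forall i j, 0 <= a i j) ->
  \esum_(i in [set: I]) \esum_(j in [set: J]) a i j =
  \esum_(j in [set: J]) \esum_(i in [set: I]) a i j.
Proof.
move=> a0; rewrite !esum_esum//.
rewrite (reindex_esum ([set: J] `*`` (fun=> [set: I]))
  ([set: I] `*`` (fun=> [set: J])) (fun k => (k.2, k.1)))//=.
split=> [[j i] //|[j i] [j' i'] _ _ [-> ->]//|[i j] _]; by exists (j, i).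
Qed.

Lemma esum_delta (I : choiceType) (i0 : I) (a : I -> \bar R) :
  (forall i, 0 <= a i) -> (forall i, i != i0 -> a i = 0) ->
  \esum_(i in [set: I]) a i = a i0.
Proof.
move=> a0 ai; rewrite -(@esum_set1 _ _ i0 a)// [RHS]esum_mkcond.
apply: eq_esum => i _; by case: ifPn => //; rewrite notin_setE => /eqP; exact: ai.
Qed.

Lemma le_esum_coord (I : choiceType) (i0 : I) (a : I -> \bar R) :
  (forall i, 0 <= a i) -> a i0 <= \esum_(i in [set: I]) a i.
Proof.
by move=> a0; apply: esum_ge; exists [set i0]; [split|rewrite fsbig_set1].
Qed.

End UnorderedSums.

(** The l^p norm of [u] is at most [c], with the sup norm for p = 0 and p = oo.
    A bound rather than a norm, so that no summability has to be carried along. *)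
Definition fam_le (R : realType) (p : exponent R) (I : choiceType) (u : I -> R)
    (c : R) : Prop :=
  match p with
  | exp_fin q _ => (\esum_(i in [set: I]) (u i `^ q)%:E <= (c `^ q)%:E)%E
  | _ => forall i, u i <= c
  end.

Section Families.
Context {R : realType} {p : exponent R}.
Implicit Types (I J : choiceType) (c d : R).

Lemma ge0_powR_le (q s t : R) : 1 <= q -> 0 <= s -> s <= t -> s `^ q <= t `^ q.
Proof.
move=> q1 s0 st; apply: ge0_ler_powR; rewrite ?nnegrE ?(le_trans s0 st)//.
exact: le_trans q1.
Qed.

Lemma powR_le_cancel (q s t : R) :
  1 <= q -> 0 <= s -> 0 <= t -> s `^ q <= t `^ q -> s <= t.
Proof.
move=> q1 s0 t0; have q0 : 0 < q by exact: lt_le_trans q1.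
by apply: contraTT; rewrite -!ltNge => ts; apply: gt0_ltr_powR.
Qed.

Lemma fam_le_mono I (u w : I -> R) c d :
  (forall i, 0 <= u i <= w i) -> 0 <= c -> c <= d ->
  fam_le p w c -> fam_le p u d.
Proof.
move=> uw c0 cd; rewrite /fam_le; case: p => [|q q1|] h; try
  by move=> i; have /andP[_ /le_trans->//] := uw i; exact: le_trans (h i) cd.
apply: le_trans (le_trans h _); last by rewrite lee_fin ge0_powR_le.
by apply: le_esum => i _; have /andP[? ?] := uw i; rewrite lee_fin ge0_powR_le.
Qed.

Lemma fam_leZ I (u : I -> R) k c : (forall i, 0 <= u i) -> 0 <= k -> 0 <= c ->
  fam_le p u c -> fam_le p (fun i => k * u i) (k * c).
Proof.
move=> u0 k0 c0; rewrite /fam_le; case: p => [|q q1|] h; try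
  by move=> i; rewrite ler_wpM2l.
under eq_esum do rewrite powRM// EFinM.
apply: le_trans (esumZ _ _) _; rewrite ?powR_ge0//.
  by move=> i; rewrite lee_fin powR_ge0.
by rewrite powRM// EFinM lee_wpmul2l// lee_fin powR_ge0.
Qed.

(** A crude substitute for Minkowski's inequality; only smallness matters in the
    sequel, so the extra factor is harmless. *)
Lemma powRD_le2 (q s t : R) : 1 <= q -> 0 <= s -> 0 <= t ->
  (s + t) `^ q <= 2 `^ q * (s `^ q + t `^ q).
Proof.
move=> q1 s0 t0; wlog st : s t s0 t0 / s <= t => [H|].
  have [|/ltW] := leP s t; first exact: H.
  by move=> ts; rewrite addrC [X in _ * X]addrC; exact: H.
apply: (@le_trans _ _ ((2 * t) `^ q)).
  by apply: ge0_powR_le; rewrite ?addr_ge0// mulr_natl mulr2n lerD2r.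
by rewrite powRM// ler_wpM2l ?powR_ge0// lerDr powR_ge0.
Qed.

(** Superadditivity: t^q = t * t^(q - 1), and the second factor increases. *)
Lemma powRD_ge (q s t : R) : 1 <= q -> 0 <= s -> 0 <= t ->
  s `^ q + t `^ q <= (s + t) `^ q.
Proof.
move=> q1 s0 t0; have q0 : 0 < q by exact: lt_le_trans q1.
rewrite -!(mulr_powRB1 _ q0) ?addr_ge0// mulrDl.
apply: lerD; apply: ler_wpM2l => //; apply: ge0_ler_powR;
  by rewrite ?nnegrE ?subr_ge0 ?addr_ge0 ?lerDl ?lerDr.
Qed.

Lemma fam_leD I (u w : I -> R) c d :
  (forall i, 0 <= u i) -> (forall i, 0 <= w i) -> 0 <= c -> 0 <= d ->
  fam_le p u c -> fam_le p w d ->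
  fam_le p (fun i => u i + w i) (2 * (c + d)).
Proof.
move=> u0 w0 c0 d0; rewrite /fam_le; case: p => [|q q1|] hu hw; try
  by move=> i; rewrite (le_trans (lerD (hu i) (hw i)))// ler_peMl ?addr_ge0// ler1n.
apply: (@le_trans _ _ (\esum_(i in [set: I])
    ((2 `^ q)%:E * ((u i `^ q)%:E + (w i `^ q)%:E)))%E).
  by apply: le_esum => i _; rewrite -EFinD -EFinM lee_fin powRD_le2.
apply: le_trans (esumZ _ _) _; first exact: powR_ge0.
  by move=> i; rewrite -EFinD lee_fin addr_ge0 ?powR_ge0.
rewrite esumD => [|i _|i _]; rewrite ?lee_fin ?powR_ge0//.
rewrite powRM ?addr_ge0// EFinM; apply: lee_wpmul2l; first by rewrite lee_fin powR_ge0.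
by apply: le_trans (leeD hu hw) _; rewrite -EFinD lee_fin powRD_ge.
Qed.

End Families.

Section LpFamilies.
Context {R : realType} {X : metricType R} {E : normedModType R[i]}.
Implicit Types (I J : choiceType) (c : R).
Local Open Scope ereal_scope.

Lemma esum_lp q (q1 : (1 <= q)%R) (f : lp X E (exp_fin q1)) :
  \esum_(x in [set: X]) (rnorm (f x) `^ q)%:E = (rnorm f `^ q)%:E.
Proof.
have q0 : q != 0%R by rewrite gt_eqF// (lt_le_trans _ q1).
have fin : \esum_(x in [set: X]) (rnorm (f x) `^ q)%:E < +oo := lpP f.
rewrite lp_rnormE /= -powRrM mulVf// powRr1 ?fineK//.
  by rewrite ge0_fin_numE// esum_ge0// => x _; rewrite lee_fin powR_ge0.
by rewrite fine_ge0// esum_ge0// => x _; rewrite lee_fin powR_ge0.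
Qed.

Lemma lp_normP p (f : lp X E p) c : (0 <= c)%R ->
  (rnorm f <= c)%R <-> fam_le p (fun x => rnorm (f x)) c.
Proof.
case: p f => [|q q1|] f c0.
- split=> [fc x|fc]; first exact: le_trans (rnorm_le_lp x (lpP f)) fc.
  have [[x _]|X0] := pselect ([set: X] !=set0).
    by apply: ge_sup; [exists (rnorm (f x)), x|move=> _ [y _ <-]; exact: fc].
  rewrite lp_rnormE /= (_ : range (fun x => rnorm (f x)) = set0) ?sup0//.
  by rewrite -subset0 => y [x _ _]; apply: X0; exists x.
- rewrite /fam_le esum_lp lee_fin; split; first exact: ge0_powR_le (rnorm_ge0 _).
  by apply: powR_le_cancel => //; exact: rnorm_ge0.
- split=> [fc x|fc]; first exact: le_trans (rnorm_le_lp x (lpP f)) fc.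
  have [[x _]|X0] := pselect ([set: X] !=set0).
    by apply: ge_sup; [exists (rnorm (f x)), x|move=> _ [y _ <-]; exact: fc].
  rewrite lp_rnormE /= (_ : range (fun x => rnorm (f x)) = set0) ?sup0//.
  by rewrite -subset0 => y [x _ _]; apply: X0; exists x.
Qed.

(** The map w |-> (u_i w)_i from l^p(X) to l^p(I; l^p(X)) is bounded by the
    largest l^p(I) norm of the columns of [u]: for finite p, sum over [I] before
    summing over [X]. *)
Lemma fam_le_mul I p (W : I -> lp X E p) (w : lp X E p) (u : I -> X -> R) c :
  (0 <= c)%R -> (forall i x, 0 <= u i x)%R ->
  (forall i x, rnorm (W i x) <= u i x * rnorm (w x))%R ->
  (forall x, fam_le p (fun i => u i x) c) ->
  fam_le p (fun i => rnorm (W i)) (c * rnorm w).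
Proof.
case: p W w => [|q q1|] W w c0 u0 Wu uc.
- move=> i; apply/lp_normP; first by rewrite mulr_ge0 ?rnorm_ge0.
  move=> x; apply: le_trans (Wu i x) _.
  apply: ler_pM; [by []|exact: rnorm_ge0|exact: uc|].
  exact: rnorm_le_lp x (lpP w).
- rewrite /fam_le.
  under eq_esum do rewrite -esum_lp.
  rewrite exchange_esum; last by move=> i x; rewrite lee_fin powR_ge0.
  apply: (@le_trans _ _ (\esum_(x in [set: X])
      ((c `^ q)%:E * (rnorm (w x) `^ q)%:E))).
    apply: le_esum => x _; rewrite muleC.
    apply: le_trans (lee_wpmul2l _ (uc x)); last by rewrite lee_fin powR_ge0.
    apply: le_trans (esumZ _ _); rewrite ?powR_ge0//; last first.
      by move=> i; rewrite lee_fin powR_ge0.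
    apply: le_esum => i _; rewrite -EFinM lee_fin -powRM ?rnorm_ge0// mulrC.
    by apply: ge0_powR_le; rewrite ?rnorm_ge0.
  apply: le_trans (esumZ _ _) _; rewrite ?powR_ge0//.
    by move=> x; rewrite lee_fin powR_ge0.
  by rewrite esum_lp powRM ?rnorm_ge0.
- move=> i; apply/lp_normP; first by rewrite mulr_ge0 ?rnorm_ge0.
  move=> x; apply: le_trans (Wu i x) _.
  apply: ler_pM; [by []|exact: rnorm_ge0|exact: uc|].
  exact: rnorm_le_lp x (lpP w).
Qed.

(** Choosing at each point of [X] at most one of the vectors [W i] contracts
    l^p(I; l^p(X)) to l^p(X). It bounds block diagonal operators for all p at once. *)
Lemma fam_le_diag I p (W : I -> lp X E p) (g : X -> R) (k : X -> option I) c :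
  (forall x, 0 <= g x <= if k x is Some i then rnorm (W i x) else 0)%R ->
  (0 <= c)%R -> fam_le p (fun i => rnorm (W i)) c -> fam_le p g c.
Proof.
case: p W => [|q q1|] W gW c0 Wc; try
  (move=> x; have /andP[_ /le_trans->//] := gW x; case: (k x) => // i;
   exact: le_trans (rnorm_le_lp x (lpP _)) (Wc i)).
apply: le_trans Wc; rewrite -/(fam_le _ _ _).
under [leRHS]eq_esum do rewrite -esum_lp.
rewrite [leRHS]exchange_esum; last by move=> i x; rewrite lee_fin powR_ge0.
apply: le_esum => x _; have /andP[g0] := gW x; case: (k x) => [i gi|g00].
  apply: le_trans (le_esum_coord i _); last by move=> j; rewrite lee_fin powR_ge0.
  by rewrite lee_fin ge0_powR_le.
have -> : g x = 0%R by apply/eqP; rewrite eq_le g0 g00.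
rewrite powR0 ?gt_eqF// ?(lt_le_trans _ q1)//.
by apply: esum_ge0 => i _; rewrite lee_fin powR_ge0.
Qed.

End LpFamilies.

(** * Discrete spaces of bounded geometry *)

Section DiscreteGeometry.
Context {R : realType} {X : metricType R}.
Context (bg : bounded_geometry X).

Definition cball (x : X) (r : R) : set X := [set y | mdist x y <= r].

Lemma finite_cball x r : finite_set (cball x r).
Proof.
have [N /(_ x) HN] := bg (normr_ge0 r).
apply: (@sub_finite_set _ _ (cball x `|r|)); last by apply/finite_set_leP; exists N.
by move=> y /le_trans; apply; exact: ler_norm.
Qed.

(** The other points of the unit ball about [x] form a finite, hence closed, set. *)
Lemma open_set1 (x : X) : open [set x].
Proof.
rewrite openE => _ ->; rewrite /interior.
have -> : [set x] = ball x (1 : R) `&` ~` (cball x 1 `\ x).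
  rewrite ballEmdist; apply/seteqP; split=> [_ ->|y /= [y1 nxy]].
    by split=> [|[_ /(_ erefl)]//]; rewrite /= mdistxx.
  by apply: contrapT => yx; apply: nxy; split=> //; rewrite /cball/= ltW.
apply: filterI; first exact: nbhsx_ballx.
apply: open_nbhs_nbhs; split; last by case=> _ /(_ erefl).
apply: closed_openC.
have /accessible_finite_set_closed :=
  hausdorff_accessible (@metric_hausdorff R X).
by apply; apply/finite_setD/finite_cball.
Qed.

Lemma nbhs_discrete (x : X) (A : set X) : nbhs x A <-> A x.
Proof.
split=> [|Ax]; first exact: nbhs_singleton.
have : nbhs x [set x] by apply: open_nbhs_nbhs; split=> //; exact: open_set1.
by apply: filterS => _ ->.
Qed.

Lemma continuous_discrete (T : topologicalType) (f : X -> T) : continuous f.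
Proof.
by move=> x A /= /nbhs_singleton Afx; apply/nbhs_discrete.
Qed.

Lemma supp_discrete (V : nmodType) (f : X -> V) : supp f = [set x | f x != 0].
Proof.
apply/seteqP; split; last exact: subset_closure.
move=> x /(_ [set x])[]; first exact/nbhs_discrete.
by move=> y [fy /= <-].
Qed.

(** If [K] were infinite, its cofinite filter would cluster at some p in K, but
    the complement of p belongs to that filter. *)
Lemma compact_finite (K : set X) : compact K -> finite_set K.
Proof.
move=> Kc; apply: contrapT => Kinf.
pose F : set_system X := [set A | finite_set (K `\` A)].
have FF : ProperFilter F.
  split; first by rewrite /F/= setD0.
  split=> [|A B|A B AB]; rewrite /F/= ?setDT//.
    by rewrite setDIr finite_setU.
  by apply: sub_finite_set; exact: setDS.
have [|p [Kp Fp]] := Kc F FF; first by rewrite /F/= setDv.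
have [||y [/= yp py]] := Fp (~` [set p]) [set p].
- rewrite /F/=; apply: (@sub_finite_set _ _ [set p]); last exact: finite_set1.
  by move=> y [_ /contrapT].
- exact/nbhs_discrete.
- exact: yp.
Qed.

Let clip (f : X -> R) (x : X) : R[i]^o := (Num.min 1 (Num.max 0 (f x)))%:C.

Let clip_subproof f : clip f \in @Cb_pred R X.
Proof.
apply/asboolP; split; first exact: continuous_discrete.
apply/bounded_rnormP; exists 1 => x; rewrite -lecR -rnormE.
rewrite -[leLHS]/(`|clip f x : R[i]|) ger0_norm ?lecR ?ler0c ?ge_min ?lexx//.
by rewrite le_min ler01 le_max lexx.
Qed.

(** Clipping to [0, 1] makes every real function a bounded continuous one, so that
    multipliers can be written without carrying bounds around. *)
Definition cb (f : X -> R) : Cb X := BContFun (clip_subproof f).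

Lemma cbE f x : 0 <= f x <= 1 -> cb f x = (f x)%:C.
Proof.
move=> /andP[f0 f1]; rewrite -[LHS]/(clip f x) /clip; congr _%:C.
by rewrite max_r// min_r.
Qed.

(** Remove from [X] a maximal set of points with disjoint [S]-balls, give it a
    colour, and repeat. A point that survives n rounds has by maximality a point
    of each of the n removed sets at distance at most 2 S; these are distinct, so
    bounded geometry limits n. *)
Lemma coloring (S : R) : 0 <= S ->
  exists N (col : X -> nat), (forall x, (col x < N)%N) /\
    forall x y w, col x = col y -> cball x S w -> cball y S w -> x = y.
Proof.
move=> S0.
(* [L n] is what is left after [n] rounds *)
pose E (A : set X) := sval (ex_maximal_disjoint_subcollection (fun z => cball z S) A).
have EP A : maximal_disjoint_subcollection (fun z => cball z S) (E A) A.
  by rewrite /E; case: ex_maximal_disjoint_subcollection.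
pose L := fix L n : set X := if n is m.+1 then L m `\` E (L m) else setT.
have LS m n x : (m <= n)%N -> L n x -> L m x.
  elim: n m => [|n IH] m; first by rewrite leqn0 => /eqP ->.
  by rewrite leq_eqVlt => /orP[/eqP -> //|/IH{}IH [/IH]].
have near A x : A x -> exists2 z, E A z & mdist x z <= S + S.
  move=> Ax; apply: contrapT => nz; have [EA Etriv /(_ (E A `|` [set x]))] := EP A.
  have ExN : ~ E A x.
    by move=> Ex; apply: nz; exists x => //; rewrite mdistxx addr_ge0.
  apply=> [||i j].
  - by split; [exact: subsetUl|move=> /(_ x (or_intror erefl))].
  - by move=> y [/EA//|->].
  - have far z w : E A z -> cball z S w -> cball x S w -> False.
      move=> Ez zw xw; apply: nz; exists z => //.
      by rewrite (le_trans (metric_triangle x w z))// lerD// metric_sym.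
    move=> [Ei|->] [Ej|->] [w [iw jw]] //.
    + by apply: Etriv => //; exists w.
    + by have := far _ _ Ei iw jw.
    + by have := far _ _ Ej jw iw.
have [N HN] := bg (addr_ge0 S0 S0).
have LN x : ~ L N.+1 x.
  move=> Lx.
  have /choice[g gP] : forall k, exists z, (k < N.+1)%N ->
      E (L k) z /\ mdist x z <= S + S.
    move=> k; have [kN|_] := boolP (k < N.+1)%N; last by exists x.
    have [z ? ?] := near (L k) x (LS _ _ _ (ltnW kN) Lx); by exists z.
  have glt k l : (k < l)%N -> (l < N.+1)%N -> g k <> g l.
    move=> kl lN gkl; have [Ek _] := gP k (ltn_trans kl lN).
    have [El _] := gP l lN; have [/(_ _ El)/(LS _ _ _ kl)[_ +] _ _] := EP (L l).
    by rewrite -gkl.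
  have ginj : {in `I_N.+1 &, injective g}.
    move=> k l /[!inE] /= kN lN gkl; have [kl|lk|//] := ltngtP k l.
      by have := glt _ _ kl lN gkl.
    by have := glt _ _ lk kN (esym gkl).
  have := card_le_trans (subset_card_le _) (HN x).
  move=> /(_ (g @` `I_N.+1)); rewrite (card_le_eql (inj_card_eq ginj)).
  rewrite card_le_II ltnn => H; suff : false by []; apply: H.
  by move=> _ [k kN <-]; have [] := gP k kN.
have exk x : exists k, `[< ~ L k.+1 x >] by exists N; apply/asboolP.
exists N.+1, (fun x => ex_minn (exk x)); split=> [x|x y w].
  by case: ex_minnP => m _; apply; apply/asboolP.
have colE z m : ex_minn (exk z) = m -> E (L m) z.
  case: ex_minnP => k /asboolP Lk kmin <-; have Lkz : L k z.
    case: k Lk kmin => // k Lk kmin; apply: contrapT => nL.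
    by have := kmin k (asboolT nL); rewrite ltnn.
  by apply: contrapT => nE; apply: Lk; split.
move=> /esym xy xw yw; have [_ Etriv _] := EP (L (ex_minn (exk x))).
by apply: Etriv; [exact: colE|exact: colE|exists w].
Qed.

End DiscreteGeometry.

(** * Multiplication operators *)

Section Multipliers.
Context {R : realType} {X : metricType R} {E : normedModType R[i]}.

Lemma rnorm_real (r : R) : rnorm (r%:C : R[i]^o) = `|r|.
Proof.
apply: (@complexI R); rewrite -rnormE -[LHS]/(`|r%:C : R[i]|).
by rewrite normc_def /= expr0n addr0 sqrtr_sqr.
Qed.

Lemma rnormZr (V : normedModType R[i]) (r : R) (v : V) :
  rnorm (r%:C *: v) = `|r| * rnorm v.
Proof. by rewrite rnormZ rnorm_real. Qed.

Lemma rnorm_sum (V : normedModType R[i]) (I : Type) (s : seq I) (P : pred I)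
    (F : I -> V) :
  rnorm (\sum_(i <- s | P i) F i) <= \sum_(i <- s | P i) rnorm (F i).
Proof.
elim/big_ind2: _ => [|x a y b xa yb|//]; first by rewrite rnorm0.
by apply: le_trans (rnormD _ _) _; rewrite lerD.
Qed.

Context {p : exponent R}.
Local Notation lp := (lp X E p).
Implicit Types (v w : lp) (a : bop lp).

Lemma lpE v w : (forall x, v x = w x) -> v = w.
Proof. by move=> vw; apply/val_inj/funext. Qed.

Lemma lpBE v w x : (v - w) x = v x - w x. Proof. by []. Qed.
Lemma lpZE (k : R[i]) v x : (k *: v) x = k *: v x. Proof. by []. Qed.

Lemma lp_sumE (I : Type) (s : seq I) (P : pred I) (F : I -> lp) x :
  (\sum_(i <- s | P i) F i) x = \sum_(i <- s | P i) F i x.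
Proof. by apply: (big_morph (fun v : lp => v x)). Qed.

Lemma bop_sumE (I : Type) (s : seq I) (P : pred I) (F : I -> bop lp) v :
  (\sum_(i <- s | P i) F i) v = \sum_(i <- s | P i) F i v.
Proof. by apply: (big_morph (fun a : bop lp => a v)). Qed.

Context (bg : bounded_geometry X).

Definition mulr_op (f : X -> R) : bop lp := mulop (cb bg f).

Lemma mulr_opE f v x : 0 <= f x <= 1 -> mulr_op f v x = (f x)%:C *: v x.
Proof. by move=> f01; rewrite mulopE cbE. Qed.

Definition chi (A : set X) : bop lp := mulr_op (fun x => (x \in A)%:R).

Lemma bool01 (b : bool) : 0 <= (b%:R : R) <= 1.
Proof. by case: b; rewrite ?lexx ?ler01. Qed.

Lemma chiE A v x : chi A v x = if x \in A then v x else 0.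
Proof.
by rewrite /chi mulr_opE ?bool01//; case: ifP; rewrite ?scale1r ?scale0r.
Qed.

Lemma chi_in A v x : A x -> chi A v x = v x.
Proof. by move=> Ax; rewrite chiE mem_set. Qed.

Lemma chi_out A v x : ~ A x -> chi A v x = 0.
Proof. by move=> Ax; rewrite chiE memNset. Qed.

Lemma rnorm_pointwise v w c : 0 <= c ->
  (forall x, rnorm (v x) <= c * rnorm (w x)) -> rnorm v <= c * rnorm w.
Proof.
move=> c0 vw; apply: (proj2 (lp_mem_le c0 vw _ (lpP w))) => _.
exact: continuous_discrete.
Qed.

Lemma rnorm_mulr_op f v : (forall x, 0 <= f x <= 1) -> rnorm (mulr_op f v) <= rnorm v.
Proof.
move=> f01; rewrite -[leRHS]mul1r; apply: rnorm_pointwise => // x.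
have /andP[f0 f1] := f01 x.
by rewrite mulr_opE// rnormZr ger0_norm// ler_wpM2r// rnorm_ge0.
Qed.

(** Finitely supported functions are dense. For p = oo they are not, which is why
    block cutdowns converge only point-wise there. *)
Lemma finite_support_approx v eps : p <> exp_infty -> 0 < eps ->
  exists2 K : set X, finite_set K & rnorm (v - chi K v) <= eps.
Proof.
move=> pN e0.
suff [K Kfin vK] : exists2 K : set X, finite_set K &
    fam_le p (fun x => if x \in K then 0 else rnorm (v x)) eps.
  exists K => //; apply/lp_normP; first exact: ltW.
  congr fam_le: vK; apply/funext => x; rewrite lpBE chiE.
  by case: ifP; rewrite ?subrr ?rnorm0 ?subr0.
have := lpP v; move: (v : X -> E) => {}v; case: p pN => [|q q1|] //= _ vp.
  have [K /(compact_finite bg) Kfin vK] := vp.2 _ e0; exists K => // x.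
  by case: ifPn; rewrite ?(ltW e0)// notin_setE => /vK/ltW.
have q0 : q != 0 by rewrite gt_eqF// (lt_le_trans _ q1).
set S := (\esum_(x in _) _)%E in vp.
have S0 : (0 <= S)%E by apply: esum_ge0 => x _; rewrite lee_fin powR_ge0.
have Sfin : S \is a fin_num by rewrite ge0_fin_numE.
have : (S - (eps `^ q)%:E < S)%E.
  by rewrite lteBlDr// lteDl// lte_fin powR_gt0.
move=> /ereal_sup_gt[_ [K [Kfin _] <-]] SK; exists K => //.
move: SK; rewrite lteBlDr//.
rewrite -esum_fset//; last by move=> x _; rewrite lee_fin powR_ge0.
rewrite /S (esumID K); last by move=> x _; rewrite lee_fin powR_ge0.
rewrite !setTI lteD2lE; last first.
  rewrite ge0_fin_numE; last by apply: esum_ge0 => x _; rewrite lee_fin powR_ge0.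
  apply: le_lt_trans vp; rewrite esum_mkcond; apply: le_esum => x _.
  by case: ifP; rewrite ?lee_fin ?powR_ge0.
move=> /ltW; apply: le_trans.
rewrite [leRHS]esum_mkcond; apply: le_esum => x _.
by rewrite in_setC; case: ifP; rewrite ?powR0.
Qed.

End Multipliers.

(** * Block cutdowns *)

Section BlockCutdown.
Context {R : realType} {X : metricType R} {E : normedModType R[i]}
  {p : exponent R}.
Context (bg : bounded_geometry X).
Local Notation lp := (lp X E p).
Implicit Types (v w : lp).
Context (J : choiceType) (k : X -> option J).

(** Blocks are the fibres of a partial map [k]; they are disjoint by construction,
    and the block that contains a point is computable from the point. *)
Definition cell (j : J) : set X := [set x | k x = Some j].

Definition cell_ind (j : J) : Cb X := cb bg (fun x => (x \in cell j)%:R).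

Lemma fam_le_cells v : fam_le p (fun j => rnorm (chi bg (cell j) v)) (rnorm v).
Proof.
rewrite -[rnorm v]mul1r.
apply: (@fam_le_mul _ _ _ _ _ _ _ (fun j x => (x \in cell j)%:R)) => //.
  by move=> j x; rewrite chiE; case: ifP; rewrite ?mul1r// rnorm0 mul0r.
move=> x; rewrite /fam_le; case: p => [|q q1|]; try by move=> j; case: (_ \in _).
have q0 : q != 0 by rewrite gt_eqF// (lt_le_trans _ q1).
rewrite powR1; case kx : (k x) => [j0|].
  rewrite (esum_delta (i0 := j0)) => [|j|j jj0].
  - by rewrite mem_set// powR1.
  - by rewrite lee_fin powR_ge0.
  - rewrite memNset ?powR0// /cell/= kx => -[/eqP].
    by rewrite eq_sym (negbTE jj0).
rewrite esum1 ?lee_fin// => j _.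
by rewrite memNset ?powR0// /cell/= kx.
Qed.

Context (a : bop lp).

Definition bcut_fun v (x : X) : E :=
  if k x is Some j then a (chi bg (cell j) v) x else 0.

Definition bcut_sum (F : seq J) : bop lp :=
  \sum_(j <- F) mulop (cell_ind j) * a * mulop (cell_ind j).

Lemma bcut_sumE F v x : uniq F -> bcut_sum F v x =
  if k x is Some j then if j \in F then a (chi bg (cell j) v) x else 0 else 0.
Proof.
move=> uF; rewrite /bcut_sum bop_sumE lp_sumE.
have termE j : (mulop (cell_ind j) * a * mulop (cell_ind j)) v x =
    if x \in cell j then a (chi bg (cell j) v) x else 0.
  by rewrite -chiE.
under eq_bigr do rewrite termE.
case kx : (k x) => [j0|]; last first.
  by rewrite big1// => j _; rewrite memNset// /cell/= kx.
case: ifPn => j0F.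
  rewrite (bigD1_seq j0)//= mem_set// big1 ?addr0// => j jj0.
  by rewrite memNset// /cell/= kx => -[/esym/eqP]; rewrite (negbTE jj0).
rewrite big_seq big1// => j jF; rewrite memNset// /cell/= kx => -[j0j].
by rewrite j0j jF in j0F.
Qed.

Lemma bcut_fam w (g : X -> R) :
  (forall x, 0 <= g x <= if k x is Some j then rnorm (a (chi bg (cell j) w) x)
                         else 0) ->
  fam_le p g (opnorm a * rnorm w).
Proof.
move=> gw; have aw0 : 0 <= opnorm a * rnorm w.
  by rewrite mulr_ge0 ?opnorm_ge0 ?rnorm_ge0.
apply: (fam_le_diag gw aw0).
apply: (@fam_le_mono _ _ _ _ (fun j => opnorm a * rnorm (chi bg (cell j) w))
  (opnorm a * rnorm w)) => //.
  by move=> j; rewrite rnorm_ge0 rnorm_opnorm.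
apply: fam_leZ; [|exact: opnorm_ge0|exact: rnorm_ge0|exact: fam_le_cells].
by move=> j; exact: rnorm_ge0.
Qed.

(** The blocks that meet a finite set carrying most of [v] suffice: what the
    partial sum omits only sees the rest of [v]. This gives both the strong
    convergence and, for p = 0, the vanishing at infinity of the limit. *)
Lemma bcut_tail v eps : p <> exp_infty -> 0 < eps -> exists F0 : {fset J},
  forall F : {fset J}, (F0 `<=` F)%fset ->
  fam_le p (fun x => rnorm (bcut_fun v x - bcut_sum F v x)) eps.
Proof.
move=> pN e0; have a1 : 0 < opnorm a + 1 by rewrite ltr_wpDl ?opnorm_ge0.
have [K Kfin vK] := finite_support_approx bg v pN (divr_gt0 e0 a1).
have finKJ : finite_set [set j | exists2 x, K x & k x = Some j].
  have : finite_set (k @` K) by exact: finite_image.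
  pose f (o : option J) := if o is Some j then [set j] else set0.
  move=> kKfin; apply: (@sub_finite_set _ _ (\bigcup_(o in k @` K) f o)).
    by move=> j [x Kx kx]; exists (Some j) => //; exists x.
  apply: bigcup_finite => // -[j|] _; [exact: finite_set1|exact: finite_set0].
exists (fset_set [set j | exists2 x, K x & k x = Some j]) => F F0F.
have vK' : opnorm a * rnorm (v - chi bg K v) <= eps.
  apply: le_trans (ler_wpM2l (opnorm_ge0 a) vK) _.
  by rewrite mulrCA ger_pMr// ler_pdivrMr// mul1r lerDl.
suff H : fam_le p (fun x => rnorm (bcut_fun v x - bcut_sum F v x))
    (opnorm a * rnorm (v - chi bg K v)).
  apply: fam_le_mono vK' H; first by move=> x; rewrite rnorm_ge0 lexx.
  by rewrite mulr_ge0 ?opnorm_ge0 ?rnorm_ge0.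
apply: bcut_fam.
move=> x; rewrite rnorm_ge0/= bcut_sumE ?fset_uniq// /bcut_fun.
case kx : (k x) => [j|]; last by rewrite subrr rnorm0.
  case: ifPn => jF; first by rewrite subrr rnorm0 rnorm_ge0.
  rewrite subr0 (_ : chi bg (cell j) v = chi bg (cell j) (v - chi bg K v))//.
  apply: lpE => y; rewrite !chiE; case: ifPn => //; rewrite inE => yj.
  rewrite lpBE chi_out ?subr0// => Ky; move: jF; rewrite -[_ \in _]/(j \in F).
  rewrite (fsubsetP F0F)// in_fset_set// inE; by exists y.
Qed.

Lemma bcut_mem v : bcut_fun v \in lp_pred p.
Proof.
have vfam : fam_le p (fun x => rnorm (bcut_fun v x)) (opnorm a * rnorm v).
  apply: bcut_fam => x; rewrite rnorm_ge0/= /bcut_fun.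
  by case: (k x) => //; rewrite rnorm0.
have [S SP Stail] : exists2 S : {fset J} -> X -> E, forall F, lp_mem p (S F) &
    p <> exp_infty -> forall eps, 0 < eps -> exists F,
      fam_le p (fun x => rnorm (bcut_fun v x - S F x)) eps.
  exists (fun F x => bcut_sum F v x); first by move=> F; exact: lpP.
  by move=> pN eps /(bcut_tail v pN)[F /(_ F (fsubset_refl F))]; exists F.
apply/asboolP; move: (bcut_fun v) (opnorm a * rnorm v) vfam Stail => g M.
rewrite /lp_mem /fam_le; case: p SP => [|q q1|] SP gfam Stail.
- split; first exact: continuous_discrete.
  move=> eps e0; have e2 : 0 < eps / 2 by rewrite divr_gt0.
  have [//|F0 gF] := Stail _ _ e2.
  have [K Kc KS] := (SP F0).2 _ e2; exists K => // x Kx.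
  rewrite -[g x](subrK (S F0 x)) [eps]splitr.
  by apply: le_lt_trans (rnormD _ _) _; rewrite ler_ltD ?KS.
- exact: le_lt_trans gfam (ltry _).
- by apply/bounded_rnormP; exists M.
Qed.

Definition bcut_lp v : lp := Lp (bcut_mem v).

Lemma bcut_linear : linear bcut_lp.
Proof.
move=> l u v; apply: lpE => x; rewrite -[LHS]/(bcut_fun (l *: u + v) x).
rewrite -[RHS]/(l *: bcut_fun u x + bcut_fun v x) /bcut_fun.
case: (k x) => [j|]; last by rewrite scaler0 addr0.
have -> : chi bg (cell j) (l *: u + v) = l *: chi bg (cell j) u + chi bg (cell j) v.
  by rewrite linearP.
by rewrite linearP.
Qed.

Lemma bcut_bounded v : rnorm (bcut_lp v) <= opnorm a * rnorm v.
Proof.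
apply/lp_normP; first by rewrite mulr_ge0 ?opnorm_ge0 ?rnorm_ge0.
apply: bcut_fam => x; rewrite rnorm_ge0/= /bcut_fun.
by case: (k x) => //; rewrite rnorm0.
Qed.

Definition bcut : bop lp := bop_of_bound bcut_linear bcut_bounded.

Lemma bcutE v x : bcut v x = bcut_fun v x. Proof. by []. Qed.

Lemma bcut_is_block_cutdown : is_block_cutdown cell_ind a bcut.
Proof.
have FF : Filter (@summability.totally J).
  by have [] := @summability.totally_filter J.
have strong : p <> exp_infty -> forall v : lp,
    (fun F : {fset J} => bcut_sum F v) @ summability.totally --> bcut v.
  move=> pN v; apply/cvgrPdist_le => /= eps eps0.
  have epsE : eps = (complex.Re eps)%:C.
    by move: eps0; rewrite ltcE /= => /andP[/eqP + _]; case: eps => ? ? /= ->.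
  have e0 : 0 < complex.Re eps by move: eps0; rewrite ltcE => /andP[].
  have [F0 F0P] := bcut_tail v pN e0.
  exists F0 => // F /F0P Ftail; rewrite rnormE epsE lecR.
  by apply/lp_normP; first exact: ltW.
have ptwise : p = exp_infty -> forall (v : lp) (x : X),
    (fun F : {fset J} => bcut_sum F v x) @ summability.totally --> bcut v x.
  move=> _ v x; apply/cvgrPdist_le => /= eps eps0.
  case kx : (k x) => [j|].
    exists [fset j]%fset => // F jF.
    rewrite bcut_sumE ?fset_uniq// /bcut_fun kx.
    rewrite (_ : j \in _) ?subrr ?normr0 ?ltW//.
    by apply: (fsubsetP jF); rewrite inE.
  exists fset0 => // F _.
  by rewrite bcut_sumE ?fset_uniq// /bcut_fun kx subrr normr0 ltW.
have by_exponent (P Q : Prop) : (p <> exp_infty -> P) -> (p = exp_infty -> Q) ->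
    match p with exp_infty => Q | _ => P end.
  by case: p => [|q q1|] hP hQ; [exact: hP|exact: hP|exact: hQ].
exact: by_exponent strong ptwise.
Qed.

End BlockCutdown.

(** * Band operators in the subalgebra *)

Section BandOperators.
Context {R : realType} {X : metricType R} {E : normedModType R[i]}
  {p : exponent R}.
Context (bg : bounded_geometry X).
Local Notation lp := (lp X E p).
Implicit Types (v w : lp) (a b : bop lp).

(** The row-wise form of finite propagation. For p = oo an operator is not
    determined by its matrix entries, so it cannot be replaced by the vanishing of
    entries far from the diagonal. *)
Definition local_at (r : R) a : Prop := forall v (x : X),
  (forall y, mdist x y <= r -> v y = 0) -> a v x = 0.

Lemma finite_propagation_local a :
  finite_propagation a -> exists2 r, 0 <= r & local_at r a.
Proof.
(* the strict inequality on supports requires a margin beyond [r] *)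
move=> [r r0 ar]; exists (r + 1); first by rewrite addr_ge0.
move=> v x vx; pose A := [set y | r + 1 < mdist x y].
have vA : chi bg A v = v.
  apply: lpE => y; rewrite chiE; case: ifPn => //.
  by rewrite notin_setE /A/= => /negP; rewrite -leNgt => /vx ->.
have supp_ind (C : set X) : supp (cb bg (fun y => (y \in C)%:R)) `<=` C.
  rewrite supp_discrete// => y; rewrite /mkset cbE ?bool01//.
  by case: (boolP (y \in C)) => [/set_mem//|_]; rewrite eqxx.
have : chi bg [set x] * a * chi bg A = 0.
  apply: ar; apply: (@lt_le_trans _ _ (r + 1)%:E); first by rewrite lte_fin ltrDl.
  apply: le_ereal_inf_tmp => _ [y /supp_ind -> [z /supp_ind Az <-]].
  by rewrite lee_fin ltW.
move=> /(congr1 (fun t : bop lp => t v x)).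
rewrite -[LHS]/(chi bg [set x] (a (chi bg A v)) x) vA chi_in//.
Qed.

Lemma local_finite_propagation a r :
  0 <= r -> local_at r a -> finite_propagation a.
Proof.
move=> r0 ar; exists r => // f f' ff'; apply: bopP => v; apply: lpE => x.
rewrite -[LHS]/(f x *: a (mulop f' v) x) -[RHS]/(0 : E).
have [->|fx] := eqVneq (f x) 0; first by rewrite scale0r.
rewrite ar ?scaler0// => y xy; rewrite mulopE.
have [->|f'y] := eqVneq (f' y) 0; first by rewrite scale0r.
move: ff'; rewrite ltNge => /negP[].
apply: (@le_trans _ _ (mdist x y)%:E); last by rewrite lee_fin.
apply: ereal_inf_lbound; exists x; first exact: subset_closure.
by exists y => //; exact: subset_closure.
Qed.

Context (B : set (bop lp)).
Context (Balg : banach_subalgebra B).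
Context (Bmul : cutdowns [set: Cb X] B [set: Cb X] = B).
Context (Bblock : closed_under_block_cutdowns B).

Lemma subalgebra_mulr_op f g b : B b -> B (mulr_op bg f * b * mulr_op bg g).
Proof. by move=> Bb; rewrite -Bmul; exists (cb bg f), b, (cb bg g). Qed.

Lemma subalgebra_bcut (J : choiceType) (k : X -> option J) b :
  B b -> B (bcut bg k b).
Proof.
move=> Bb; apply: Bblock Bb (bcut_is_block_cutdown bg k b).
- move=> j x; rewrite cbE ?bool01//.
  by case: (_ \in _); rewrite ?lexx ?ler01.
- move=> i j _ _ [x []]; rewrite !supp_discrete// /mkset.
  rewrite !cbE ?bool01//.
  case: (boolP (x \in cell k i)) => [/set_mem xi _|]; last by rewrite eqxx.
  case: (boolP (x \in cell k j)) => [/set_mem xj _|]; last by rewrite eqxx.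
  by apply: Some_inj; rewrite -xi.
Qed.

Lemma subalgebra_sum (I : Type) (s : seq I) (F : I -> bop lp) :
  (forall i, B (F i)) -> B (\sum_(i <- s) F i).
Proof. by have [B0 BD _ _ _] := Balg; move=> BF; elim/big_ind: _. Qed.

(** With a colouring that makes the [S]-balls of one colour disjoint, the terms of
    colour n add up to a block cutdown of [b] multiplied on both sides by the
    functions that glue the [psi z] and the [phi z] of that colour. So the whole
    sum is a finite sum of elements of the subalgebra. *)
Lemma band_operator (S : R) (psi phi : X -> X -> R) b :
  0 <= S -> B b ->
  (forall z x, 0 <= psi z x <= 1) -> (forall z x, 0 <= phi z x <= 1) ->
  (forall z x, S < mdist z x -> psi z x = 0) ->
  (forall z x, S < mdist z x -> phi z x = 0) ->
  exists b', [/\ B b', finite_propagation b' & forall v x, b' v x =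
    \sum_(z <- fset_set (cball x S))
      (psi z x)%:C *: b (mulr_op bg (phi z) v) x].
Proof.
move=> S0 Bb psi01 phi01 psiS phiS.
have [N [col [colN col_inj]]] := coloring bg S0.
(* [k n x] is the centre of the ball of colour [n] that contains [x], if any *)
have /choice[k kP] : forall n, exists k : X -> option X,
    forall x z, k x = Some z <-> col z = n /\ mdist z x <= S.
  move=> n; suff /choice[k kP] : forall x, exists o, forall z, o = Some z <->
      col z = n /\ mdist z x <= S by exists k.
  move=> x; have [[z [zn zx]]|nz] := pselect (exists z, col z = n /\ mdist z x <= S).
    exists (Some z) => z'; split=> [[<-]//|[zn' zx']]; congr Some.
    by apply: (col_inj _ _ x); rewrite ?zn ?zn'.
  by exists None => z; split=> // zP; case: nz; exists z.
pose glue (f : X -> X -> R) n x := if k n x is Some z then f z x else 0.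
have glue01 f n x : (forall z y, 0 <= f z y <= 1) -> 0 <= glue f n x <= 1.
  by rewrite /glue => f01; case: (k n x); rewrite ?lexx ?ler01.
pose b' := \sum_(n <- iota 0 N)
  mulr_op bg (glue psi n) * bcut bg (k n) b * mulr_op bg (glue phi n).
have b'E v x : b' v x = \sum_(z <- fset_set (cball x S))
      (psi z x)%:C *: b (mulr_op bg (phi z) v) x.
  pose G z := (psi z x)%:C *: b (mulr_op bg (phi z) v) x.
  have -> : b' v x = \sum_(n <- iota 0 N) if k n x is Some z then G z else 0.
    rewrite /b' bop_sumE lp_sumE; apply: eq_bigr => n _.
    rewrite -[LHS]/(mulr_op bg (glue psi n)
      (bcut bg (k n) b (mulr_op bg (glue phi n) v)) x).
    rewrite mulr_opE ?glue01// bcutE /bcut_fun /glue.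
    case kx : (k n x) => [z|]; last by rewrite scaler0.
    rewrite /G; congr (_ *: b _ _); apply: lpE => y.
    rewrite chiE !mulr_opE ?glue01// /glue.
    case: ifPn; first by rewrite inE /cell/= => ->.
    rewrite notin_setE /cell/= => kyz; rewrite phiS ?scale0r//.
    rewrite ltNge; apply/negP => zy; apply: kyz; apply/kP; split=> //.
    by have [] := (kP n x z).1 kx.
  have in_ball z : (z \in fset_set (cball x S)) = (mdist z x <= S).
    rewrite in_fset_set; last exact: finite_cball.
    rewrite [mdist z x]metric_sym.
    by apply/idP/idP => [/set_mem //|h]; apply/mem_set.
  rewrite -/(G _); transitivity (\sum_(z <- fset_set (cball x S))
      \sum_(n <- iota 0 N) if col z == n then G z else 0); last first.
    apply: eq_bigr => z _.
    rewrite (bigD1_seq (col z)) ?iota_uniq ?mem_iota//= eqxx big1 ?addr0// => n.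
    by rewrite eq_sym => /negbTE ->.
  rewrite exchange_big; apply: eq_bigr => n _.
  case kx : (k n x) => [z|].
    have [zn zx] := (kP n x z).1 kx.
    rewrite (bigD1_seq z) ?fset_uniq ?in_ball//= zn eqxx big_seq_cond big1 ?addr0//.
    move=> z' /andP[]; rewrite in_ball => z'x z'z; case: eqP => // z'n.
    have /(kP n x z').2 : col z' = n /\ mdist z' x <= S by [].
    by rewrite kx => -[zz']; rewrite zz' eqxx in z'z.
  rewrite big_seq big1// => z; rewrite in_ball => zx; case: eqP => // zn.
  have /(kP n x z).2 : col z = n /\ mdist z x <= S by [].
  by rewrite kx.
exists b'; split=> //.
- apply: subalgebra_sum => n; apply: subalgebra_mulr_op; exact: subalgebra_bcut.
- apply: (@local_finite_propagation _ (S + S)); first exact: addr_ge0.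
  move=> v x vx; rewrite b'E big_seq big1// => z.
  rewrite in_fset_set; last exact: finite_cball.
  move=> /set_mem; rewrite /cball /mkset => xz.
  rewrite (_ : mulr_op bg (phi z) v = 0) ?linear0 ?scaler0//.
  apply: lpE => y; rewrite mulr_opE// -[RHS]/(0 : E).
  have [zy|/phiS ->] := leP (mdist z y) S; last by rewrite scale0r.
  rewrite vx ?scaler0//; apply: le_trans (metric_triangle x z y) _.
  exact: lerD.
Qed.

End BandOperators.

(** * Columns of operators and slowly varying families *)

Section ColumnNorm.
Context {R : realType} {X : metricType R} {E : normedModType R[i]}
  {p : exponent R}.
Local Notation lp := (lp X E p).
Local Notation bop := (bop lp).
Implicit Types (v w : lp) (a b s : bop) (I : choiceType) (c d : R).

Lemma closure_opnormP (A : set bop) a :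
  closure A a <-> forall eps : R, 0 < eps -> exists2 t, A t & opnorm (a - t) < eps.
Proof.
split=> [Aa eps e0|Aa U].
  have [] := Aa [set t | opnorm (a - t) < eps].
    have := nbhsx_ballx a eps%:C; rewrite ltcR => /(_ e0).
    apply: filterS => t; rewrite -ball_normE /= => at_.
    by rewrite -ltcR -bop_rnormE -rnormE.
  by move=> t [At /= ?]; exists t.
move=> /nbhs_ballP[eps /= eps0 aU].
have epsE : eps = (complex.Re eps)%:C.
  by move: eps0; rewrite ltcE /= => /andP[/eqP + _]; case: eps {aU} => ? ? /= ->.
have e0 : 0 < complex.Re eps by move: eps0; rewrite ltcE => /andP[].
have [t At ate] := Aa _ e0; exists t; split=> //; apply: aU.
by rewrite -ball_normE /= epsE rnormE ltcR.
Qed.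

Lemma bopME a b v : (a * b) v = a (b v). Proof. by []. Qed.

Lemma opnormM a b : opnorm (a * b) <= opnorm a * opnorm b.
Proof.
apply: opnorm_le => [|v]; first by rewrite mulr_ge0 ?opnorm_ge0.
rewrite bopME -mulrA.
by rewrite (le_trans (rnorm_opnorm a _))// ler_wpM2l ?opnorm_ge0 ?rnorm_opnorm.
Qed.

(** The norm of v |-> (T_i v)_i as an operator from l^p(X; E) to
    l^p(I; l^p(X; E)). *)
Definition col_le I (T : I -> bop) c :=
  forall v, fam_le p (fun i => rnorm (T i v)) (c * rnorm v).

Lemma col_le_mono I (T : I -> bop) c d :
  0 <= c -> c <= d -> col_le T c -> col_le T d.
Proof.
move=> c0 cd Tc v; apply: fam_le_mono (Tc v).
- by move=> i; rewrite rnorm_ge0 lexx.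
- by rewrite mulr_ge0 ?rnorm_ge0.
- by rewrite ler_wpM2r ?rnorm_ge0.
Qed.

Lemma col_leD I (T S : I -> bop) c d : 0 <= c -> 0 <= d ->
  col_le T c -> col_le S d -> col_le (fun i => T i + S i) (2 * (c + d)).
Proof.
move=> c0 d0 Tc Sd v; rewrite -mulrA [(c + d) * _]mulrDl.
have cv : 0 <= c * rnorm v by rewrite mulr_ge0 ?rnorm_ge0.
have dv : 0 <= d * rnorm v by rewrite mulr_ge0 ?rnorm_ge0.
have TS := fam_leD (fun i => rnorm_ge0 (T i v)) (fun i => rnorm_ge0 (S i v)) cv dv
  (Tc v) (Sd v).
apply: fam_le_mono (lexx _) TS; last by rewrite mulr_ge0 ?addr_ge0.
by move=> i; apply/andP; split; [exact: rnorm_ge0|exact: rnormD].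
Qed.

Lemma col_leN I (T : I -> bop) c : col_le T c -> col_le (fun i => - T i) c.
Proof.
move=> Tc v; rewrite (_ : (fun i => _) = (fun i => rnorm (T i v)))//.
by apply/funext => i; rewrite -[X in rnorm X = _]/(- T i v) rnormN.
Qed.

Lemma col_leMl I (T : I -> bop) s c : 0 <= c ->
  col_le T c -> col_le (fun i => s * T i) (opnorm s * c).
Proof.
move=> c0 Tc v; have cv : 0 <= c * rnorm v by rewrite mulr_ge0 ?rnorm_ge0.
have sT := fam_leZ (fun i => rnorm_ge0 (T i v)) (opnorm_ge0 s) cv (Tc v).
rewrite -mulrA; apply: fam_le_mono (lexx _) sT.
  move=> i; apply/andP; split; first exact: rnorm_ge0.
  exact: (rnorm_opnorm s (T i v)).
by rewrite mulr_ge0 ?opnorm_ge0.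
Qed.

Lemma col_leMr I (T : I -> bop) s c : 0 <= c ->
  col_le T c -> col_le (fun i => T i * s) (c * opnorm s).
Proof.
move=> c0 Tc v; apply: fam_le_mono (Tc (s v)).
- by move=> i; rewrite rnorm_ge0 lexx.
- by rewrite mulr_ge0 ?rnorm_ge0.
- by rewrite -mulrA ler_wpM2l// rnorm_opnorm.
Qed.

End ColumnNorm.

Section VanishingFamilies.
Context {R : realType} {X : metricType R} {E : normedModType R[i]}
  {p : exponent R}.
Context (bg : bounded_geometry X).
Local Notation lp := (lp X E p).
Local Notation bop := (bop lp).
Implicit Types (v w : lp) (a b s k : bop) (I : choiceType) (T S : (X -> R) -> bop).

(** [phi], seen as a map from [X] to the unit ball of l^p(I), moves by at most
    [delta] over distances at most [r]. *)
Definition small_variation (r delta : R) I (phi : I -> X -> R) :=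
  [/\ forall i x, 0 <= phi i x <= 1,
      forall x, fam_le p (fun i => phi i x) 1
    & forall x y, mdist x y <= r ->
        fam_le p (fun i => `|phi i x - phi i y|) delta].

(** [T] has small columns on every family of small variation. The index set is
    quantified inside: a single function gives norm bounds for commutators, and a
    partition of unity gives the amplified bounds. *)
Definition vanishing T := forall eps, 0 < eps -> exists r delta, 0 < delta /\
  forall I (phi : I -> X -> R), small_variation r delta phi ->
    col_le (fun i => T (phi i)) eps.

Lemma small_variation_mono r r' delta delta' I (phi : I -> X -> R) :
  r <= r' -> 0 <= delta' -> delta' <= delta ->
  small_variation r' delta' phi -> small_variation r delta phi.
Proof.
move=> rr d0 dd [phi01 phi1 phiv]; split=> // x y xy.
apply: fam_le_mono (phiv x y (le_trans xy rr)) => //.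
by move=> i; rewrite normr_ge0 lexx.
Qed.

Lemma vanishingD T S : vanishing T -> vanishing S -> vanishing (T \+ S).
Proof.
move=> Tv Sv eps e0; have e4 : 0 < eps / 4 by rewrite divr_gt0.
have [r [d [d0 Td]]] := Tv _ e4; have [r' [d' [d'0 Sd]]] := Sv _ e4.
exists (Num.max r r'), (Num.min d d'); split; first by rewrite lt_min d0.
have dd0 : 0 <= Num.min d d' by rewrite le_min !ltW.
move=> I phi phiv; have -> : eps = 2 * (eps / 4 + eps / 4) by field.
apply: col_leD; rewrite ?(ltW e4)//.
- apply: Td; apply: small_variation_mono phiv => //; first by rewrite le_max lexx.
  by rewrite ge_min lexx.
- apply: Sd; apply: small_variation_mono phiv => //; first by rewrite le_max lexx orbT.
  by rewrite ge_min lexx orbT.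
Qed.

Lemma vanishingN T : vanishing T -> vanishing (fun f => - T f).
Proof.
move=> Tv eps /Tv[r [d [d0 Td]]]; exists r, d; split=> // I phi /Td.
exact: col_leN.
Qed.

Lemma vanishingMl T s : vanishing T -> vanishing (fun f => s * T f).
Proof.
move=> Tv eps e0; have s1 : 0 < opnorm s + 1 by rewrite ltr_wpDl ?opnorm_ge0.
have e' := divr_gt0 e0 s1; have [r [d [d0 Td]]] := Tv _ e'.
exists r, d; split=> // I phi /Td /(col_leMl s (ltW e')); apply: col_le_mono.
  by rewrite mulr_ge0 ?opnorm_ge0 ?ltW.
by rewrite mulrCA ger_pMr// ler_pdivrMr// mul1r lerDl.
Qed.

Lemma vanishingMr T s : vanishing T -> vanishing (fun f => T f * s).
Proof.
move=> Tv eps e0; have s1 : 0 < opnorm s + 1 by rewrite ltr_wpDl ?opnorm_ge0.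
have e' := divr_gt0 e0 s1; have [r [d [d0 Td]]] := Tv _ e'.
exists r, d; split=> // I phi /Td /(col_leMr s (ltW e')); apply: col_le_mono.
  by rewrite mulr_ge0 ?opnorm_ge0 ?ltW.
by rewrite mulrAC ler_pdivrMr// ler_pM2l// lerDl.
Qed.

Lemma vanishing_approx T :
  (forall eta, 0 < eta -> exists2 S, vanishing S &
    forall r delta I (phi : I -> X -> R), small_variation r delta phi ->
      col_le (fun i => T (phi i) - S (phi i)) eta) ->
  vanishing T.
Proof.
move=> TS eps e0; have e4 : 0 < eps / 4 by rewrite divr_gt0.
have [S Sv TSe] := TS _ e4; have [r [d [d0 Sd]]] := Sv _ e4.
exists r, d; split=> // I phi phiv.
have -> : eps = 2 * (eps / 4 + eps / 4) by field.
have := col_leD (ltW e4) (ltW e4) (TSe _ _ _ _ phiv) (Sd _ _ phiv).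
by congr col_le; apply/funext => i; rewrite subrK.
Qed.

Definition comm a (f : X -> R) : bop := mulr_op bg f * a - a * mulr_op bg f.

Definition dev (x0 : X) (f : X -> R) : bop := mulr_op bg f - (f x0)%:C *: (1 : bop).

Lemma devE x0 f v x : 0 <= f x <= 1 -> dev x0 f v x = (f x - f x0)%:C *: v x.
Proof.
move=> f01; rewrite -[LHS]/(mulr_op bg f v x - (f x0)%:C *: v x).
by rewrite mulr_opE// -scalerBl rmorphB.
Qed.

Lemma fam_le0 I c : 0 <= c -> fam_le p (fun _ : I => 0) c.
Proof.
move=> c0; rewrite /fam_le; case: p => [//|q q1|//].
rewrite esum1 ?lee_fin ?powR_ge0// => i _.
by rewrite powR0// gt_eqF// (lt_le_trans _ q1).
Qed.

Lemma col_le_mulr_op r delta I (phi : I -> X -> R) :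
  small_variation r delta phi -> col_le (fun i => mulr_op bg (phi i) : bop) 1.
Proof.
move=> [phi01 phi1 _] v; apply: (@fam_le_mul _ _ _ _ _ _ _ phi) => //.
  by move=> i x; have /andP[] := phi01 i x.
move=> i x; rewrite mulr_opE// rnormZr ger0_norm//.
by have /andP[] := phi01 i x.
Qed.

Lemma col_le_dev (A : set X) x0 c I (phi : I -> X -> R) : 0 <= c ->
  (forall i x, 0 <= phi i x <= 1) ->
  (forall x, A x -> fam_le p (fun i => `|phi i x - phi i x0|) c) ->
  col_le (fun i => chi bg A * dev x0 (phi i)) c.
Proof.
move=> c0 phi01 phiA v.
apply: (@fam_le_mul _ _ _ _ _ _ _
  (fun i x => if x \in A then `|phi i x - phi i x0| else 0)) => //.
- by move=> i x; case: ifP.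
- move=> i x; rewrite bopME chiE.
  by case: ifP; rewrite ?devE// ?rnormZr// rnorm0 mul0r.
- by move=> x; case: (boolP (x \in A)) => [/set_mem/phiA//|_]; exact: fam_le0.
Qed.

Lemma chi_dev_comm (A : set X) x0 f : (forall x, 0 <= f x <= 1) ->
  chi bg A * dev x0 f = dev x0 f * chi bg A.
Proof.
move=> f01; apply: bopP => v; apply: lpE => x.
by rewrite !bopME chiE !devE// chiE; case: ifP; rewrite ?scaler0.
Qed.

Lemma chiT : chi bg [set: X] = 1 :> bop.
Proof. by apply: bopP => v; apply: lpE => x; rewrite chi_in. Qed.

Lemma col_le_dev4 r delta x0 I (phi : I -> X -> R) :
  small_variation r delta phi -> col_le (fun i => dev x0 (phi i)) 4.
Proof.
move=> [phi01 phi1 _].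
have phi0 x i : 0 <= phi i x by have /andP[] := phi01 i x.
have := @col_le_dev [set: X] x0 4 I phi; rewrite chiT.
under eq_fun do rewrite mul1r.
apply=> // x _; rewrite (_ : 4 = 2 * (1 + 1)); last by ring.
have := fam_leD (phi0 x) (phi0 x0) ler01 ler01 (phi1 x) (phi1 x0).
apply: fam_le_mono => // i.
by rewrite normr_ge0 (le_trans (ler_normB _ _))// !ger0_norm.
Qed.

(** A finite set lies in a ball about [x0], on which a family of small variation
    is close to its value at [x0]. *)
Lemma vanishing_dev_finite (F : set X) x0 : finite_set F ->
  vanishing (fun f => chi bg F * dev x0 f).
Proof.
move=> Ffin eps e0.
have [r Fr] : exists r, forall x, F x -> mdist x x0 <= r.
  exists (\sum_(x <- fset_set F) mdist x x0) => x Fx.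
  rewrite (bigD1_seq x) ?fset_uniq ?in_fset_set ?inE//= lerDl.
  by apply: sumr_ge0 => y _; exact: mdist_ge0.
exists r, eps; split=> // I phi [phi01 phi1 phiv].
by apply: col_le_dev; rewrite ?(ltW e0)// => x Fx; apply: phiv; exact: Fr.
Qed.

(** Concentrated on a finite set, on both sides, up to a small norm. *)
Definition tight k := forall eta, 0 < eta -> exists2 F, finite_set F &
  opnorm (k - chi bg F * k) <= eta /\ opnorm (k - k * chi bg F) <= eta.

Lemma vanishing_dev_tight k x0 : tight k -> vanishing (fun f => dev x0 f * k).
Proof.
move=> kt; apply: vanishing_approx => eta e0.
have e4 : 0 < eta / 4 by rewrite divr_gt0.
have [F Ffin [Fk _]] := kt _ e4.
exists (fun f => chi bg F * dev x0 f * k).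
  exact/vanishingMr/vanishing_dev_finite.
move=> r delta I phi phiv; have [phi01 _ _] := phiv.
under eq_fun do rewrite chi_dev_comm// -mulrA -mulrBr.
apply: col_le_mono (col_leMr _ _ (col_le_dev4 x0 phiv)) => //.
  by rewrite mulr_ge0 ?opnorm_ge0.
by rewrite -ler_pdivlMl// mulrC.
Qed.

Lemma vanishing_tight_dev k x0 : tight k -> vanishing (fun f => k * dev x0 f).
Proof.
move=> kt; apply: vanishing_approx => eta e0.
have e4 : 0 < eta / 4 by rewrite divr_gt0.
have [F Ffin [_ Fk]] := kt _ e4.
exists (fun f => k * (chi bg F * dev x0 f)).
  exact/vanishingMl/vanishing_dev_finite.
move=> r delta I phi phiv; have [phi01 _ _] := phiv.
under eq_fun do rewrite mulrA -mulrBl.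
apply: col_le_mono (col_leMl _ _ (col_le_dev4 x0 phiv)) => //.
  by rewrite mulr_ge0 ?opnorm_ge0.
by rewrite -ler_pdivlMr.
Qed.

End VanishingFamilies.

(** * Commutators with a Fredholm inverse *)

Section PairFamilies.
Context {R : realType} {X : metricType R} {E : normedModType R[i]}
  {p : exponent R}.
Local Notation lp := (lp X E p).

Lemma esum_pair (I J : choiceType) (a : I -> J -> \bar R) :
  (forall i j, 0 <= a i j)%E ->
  (\esum_(k in [set: I * J]) a k.1 k.2 =
   \esum_(i in [set: I]) \esum_(j in [set: J]) a i j)%E.
Proof.
move=> a0; rewrite esum_esum//; congr esum.
by apply/seteqP; split.
Qed.

Lemma fam_le_pair (I : choiceType) (W : I -> lp) (c : R) :
  fam_le p (fun k : I * X => rnorm (W k.1 k.2)) c ->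
  0 <= c -> fam_le p (fun i => rnorm (W i)) c.
Proof.
case: p W => [|q q1|] W Wc c0; try
  by move=> i; apply/lp_normP => // x; exact: (Wc (i, x)).
apply: le_trans Wc; rewrite -/(fam_le _ _ _).
rewrite (esum_pair (a := fun i x => (rnorm (W i x) `^ q)%:E)).
  by apply: le_esum => i _; rewrite esum_lp.
by move=> i x; rewrite lee_fin powR_ge0.
Qed.

End PairFamilies.

Section FredholmInverse.
Context {R : realType} {X : metricType R} {E : normedModType R[i]}
  {p : exponent R}.
Context (bg : bounded_geometry X).
Local Notation lp := (lp X E p).
Local Notation bop := (bop lp).
Implicit Types (v w : lp) (a b s k : bop) (I : choiceType).

(** For fixed [y], each of the at most [N] points x near [y] contributes at most
    [delta], so the sum over [I] and these x is under control. *)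
Lemma fam_le_near (r : R) (N : nat) (delta : R) I (phi : I -> X -> R) y :
  (forall x : X, (cball x r #<= `I_N)%card) -> 0 <= delta ->
  (forall x y, mdist x y <= r -> fam_le p (fun i => `|phi i x - phi i y|) delta) ->
  fam_le p (fun k : I * X =>
    if mdist k.2 y <= r then `|phi k.1 k.2 - phi k.1 y| else 0) (N.+1%:R * delta).
Proof.
move=> HN d0; rewrite /fam_le; case: p => [|q q1|] phiv; try
  by move=> [i x] /=; case: ifP => [/phiv/(_ i)/le_trans->//|_];
    rewrite ?mulr_ge0// ler_peMl// ler1n.
have q0 : q != 0 by rewrite gt_eqF// (lt_le_trans _ q1).
pose g i x : \bar R :=
  ((if mdist x y <= r then `|phi i x - phi i y| else 0) `^ q)%:E.
have g0 i x : (0 <= g i x)%E by rewrite lee_fin powR_ge0.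
rewrite (esum_pair g0) exchange_esum//.
apply: (@le_trans _ _ (\esum_(x in cball y r) (delta `^ q)%:E)%E).
  rewrite [leRHS]esum_mkcond; apply: le_esum => x _; rewrite /g.
  have [xy|xy] := boolP (mdist x y <= r).
    by rewrite mem_set; [exact: phiv|rewrite /cball/= metric_sym].
  rewrite esum1; last by move=> i _; rewrite powR0.
  by case: ifP; rewrite ?lee_fin ?powR_ge0.
have fin := finite_cball bg y r.
rewrite esum_fset//; last by move=> x _; rewrite lee_fin powR_ge0.
rewrite fsbig_finite//= sumEFin lee_fin big_const_seq count_predT iter_addr_0.
rewrite -[X in X <= _]mulr_natl powRM//; apply: ler_wpM2r; first exact: powR_ge0.
apply: (@le_trans _ _ N.+1%:R); last by apply: le1r_powR; rewrite ?ler1n.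
rewrite ler_nat; apply: (@leq_trans N) => //; exact: geq_card_fset_set.
Qed.

(** At x, the commutator with [phi i] applied to v is the value at x of [a]
    applied to (phi_i(x) - phi_i) v restricted to the [r]-ball about x. Summing
    over all i and x the norms of these vectors, instead of their single values
    at x, only costs the number of points of a ball. *)
Lemma vanishing_comm_local r a : local_at r a -> vanishing (comm bg a).
Proof.
move=> ar eps e0.
have [N HN] : exists N, forall x : X, (cball x r #<= `I_N)%card.
  have [N HN] := bg (normr_ge0 r); exists N => x; apply: card_le_trans (HN x).
  by apply: subset_card_le => y /le_trans; apply; exact: ler_norm.
pose C := opnorm a * N.+1%:R; have C0 : 0 <= C by rewrite mulr_ge0 ?opnorm_ge0.
have C1 : 0 < C + 1 by rewrite ltr_wpDl.
have d0 : 0 < eps / (C + 1) by rewrite divr_gt0.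
exists r, (eps / (C + 1)); split=> // I phi [phi01 _ phiv] v.
apply: fam_le_pair; last by rewrite mulr_ge0 ?rnorm_ge0 ?ltW.
pose W (k : I * X) : lp := chi bg (cball k.2 r)
  ((phi k.1 k.2)%:C *: v - mulr_op bg (phi k.1) v).
have commW i x : comm bg a (phi i) v x = a (W (i, x)) x.
  have -> : comm bg a (phi i) v x =
      a ((phi i x)%:C *: v - mulr_op bg (phi i) v) x.
    rewrite linearB linearZ -[LHS]/(mulr_op bg (phi i) (a v) x -
      a (mulr_op bg (phi i) v) x).
    by rewrite mulr_opE.
  apply/eqP; rewrite -subr_eq0 -lpBE -linearB; apply/eqP/ar => y xy.
  by rewrite lpBE /W chi_in ?subrr.
have := fam_le_mul (c := N.+1%:R * (eps / (C + 1))) (W := W) (w := v)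
  (u := fun ix y => if mdist ix.2 y <= r then `|phi ix.1 ix.2 - phi ix.1 y| else 0).
move=> /(_ _ _ _ (fun y => fam_le_near y HN (ltW d0) phiv)) H.
have {}H : fam_le p (fun ix => rnorm (W ix)) (N.+1%:R * (eps / (C + 1)) * rnorm v).
  apply: H => [||[i x] y].
  - by rewrite mulr_ge0// ltW.
  - by move=> ix y; case: ifP.
  - rewrite /W chiE; case: (boolP (y \in _)) => [/set_mem xy|_]; last first.
      by rewrite rnorm0 mulr_ge0 ?rnorm_ge0//; case: ifP.
    rewrite ifT; last exact: xy.
    by rewrite -rnormZr rmorphB scalerBl lpBE lpZE mulr_opE.
have NCv : 0 <= N.+1%:R * (eps / (C + 1)) * rnorm v.
  by rewrite mulr_ge0 ?rnorm_ge0// mulr_ge0// ltW.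
have := fam_leZ (fun ix => rnorm_ge0 (W ix)) (opnorm_ge0 a) NCv H.
apply: fam_le_mono.
- move=> [i x]; rewrite rnorm_ge0 commW andTb; apply: le_trans (rnorm_opnorm a (W (i, x))).
  exact: rnorm_le_lp _ (lpP _).
- by rewrite mulr_ge0 ?opnorm_ge0.
- rewrite !mulrA -/C; apply: ler_wpM2r; first exact: rnorm_ge0.
  by rewrite ler_pdivrMr// mulrC ler_pM2l// lerDl.
Qed.

Lemma vanishing_comm_closure a :
  closure finite_propagation a -> vanishing (comm bg a).
Proof.
move=> /closure_opnormP aF; apply: vanishing_approx => eta e0.
have e4 : 0 < eta / 4 by rewrite divr_gt0.
have [a0 /(finite_propagation_local bg)[r r0 /vanishing_comm_local a0v] a0e] :=
  aF _ e4.
exists (comm bg a0) => // r' d I phi phiv.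
have M1 : col_le (fun i => mulr_op bg (phi i) : bop) 1.
  exact: col_le_mulr_op phiv.
have := col_leD _ _ (col_leMr (a - a0) ler01 M1) (col_leN (col_leMl (a - a0) ler01 M1)).
rewrite mul1r mulr1 => /(_ (opnorm_ge0 _) (opnorm_ge0 _)).
rewrite (_ : (fun i => _ + _) = (fun i => comm bg a (phi i) - comm bg a0 (phi i))).
  apply: col_le_mono; first by rewrite mulr_ge0// addr_ge0 ?opnorm_ge0.
  by move: (opnorm _) a0e => t ta; lra.
apply/funext => i; rewrite /comm mulrBr mulrBl !opprB.
by rewrite addrACA [RHS]addrACA [- _ - _]addrC.
Qed.

Lemma bopZl (l : R[i]) a b : (l *: a) * b = l *: (a * b).
Proof. exact: bopP. Qed.

Lemma bopZr (l : R[i]) a b : a * (l *: b) = l *: (a * b).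
Proof. by apply: bopP => v; exact: linearZ. Qed.

(** Sandwiching the commutator of [f] and [a] between two copies of [b] produces
    the one of [f] and [b], up to two error terms. Replacing [f] by [dev x0 f] in
    these does not change their sum, because b (1 - ab) = (1 - ba) b. *)
Lemma comm_inverse a b x0 f :
  comm bg b f = - (b * comm bg a f * b) - b * (dev bg x0 f * (1 - a * b))
                + (1 - b * a) * dev bg x0 f * b.
Proof.
pose F : bop := mulr_op bg f; pose l := (f x0)%:C.
have -> : dev bg x0 f = F - l *: (1 : bop) by [].
rewrite -[comm bg a f]/(F * a - a * F) -[comm bg b f]/(F * b - b * F).
have e1 : b * ((F - l *: (1 : bop)) * (1 - a * b)) =
    b * F - b * F * (a * b) - l *: (b - b * a * b).
  rewrite mulrBl mulrBr bopZl mul1r bopZr; congr (_ - _ *: _).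
    by rewrite mulrBr mulr1 mulrBr mulrA.
  by rewrite mulrBr mulr1 mulrA.
have e2 : (1 - b * a) * (F - l *: (1 : bop)) * b =
    F * b - b * a * F * b - l *: (b - b * a * b).
  rewrite mulrBr mulrBl bopZr mulr1 bopZl !mulrBl !mul1r.
  by [].
rewrite e1 e2.
have -> : b * (F * a - a * F) * b = b * F * (a * b) - b * a * F * b.
  by rewrite mulrBr mulrBl !mulrA.
rewrite !opprB; move: (l *: _) (b * F * (a * b)) (b * a * F * b) => t u w.
rewrite [w - u + _]addrCA [w - u + _]addrA subrK [t + _]addrC addrACA subrr addr0.
by rewrite addrC addrA subrK.
Qed.

Lemma vanishing_comm_inverse a b (x0 : X) :
  closure finite_propagation a -> tight bg (1 - a * b) -> tight bg (1 - b * a) ->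
  vanishing (comm bg b).
Proof.
move=> aF abt bat.
rewrite (_ : comm bg b = (fun f => - (b * comm bg a f * b)) \+
  (fun f => - (b * (dev bg x0 f * (1 - a * b)))) \+
  (fun f => (1 - b * a) * dev bg x0 f * b)); last first.
  by apply/funext => f; exact: comm_inverse.
apply: vanishingD; last exact/vanishingMr/vanishing_tight_dev.
apply: vanishingD; apply: vanishingN.
  exact/vanishingMr/vanishingMl/vanishing_comm_closure.
exact/vanishingMl/vanishing_dev_tight.
Qed.

Lemma opnorm_chi (F : set X) : opnorm (chi bg F : bop) <= 1.
Proof.
by apply: opnorm_le => // v; rewrite mul1r; apply: rnorm_mulr_op => x; exact: bool01.
Qed.

(** A function that vanishes at infinity is small off a finite set; the statement
    for all larger sets lets one set serve two functions. *)
Lemma C0_tail (f : Cb X) eta : C0 f -> 0 < eta -> exists2 F, finite_set F &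
  forall G, F `<=` G -> opnorm (mulop f - chi bg G * mulop f : bop) <= eta.
Proof.
move=> f0 e0; have [K /(compact_finite bg) Kfin Kf] := f0 _ e0.
exists K => // G KG; apply: opnorm_le => [|v]; first exact: ltW.
apply: (rnorm_pointwise bg) => [|x]; first exact: ltW.
have -> : (mulop f - chi bg G * mulop f) v x = mulop f v x - chi bg G (mulop f v) x.
  by [].
rewrite chiE; case: ifPn => [_|].
  by rewrite subrr rnorm0 mulr_ge0 ?rnorm_ge0 ?ltW.
rewrite notin_setE => Gx; rewrite subr0 mulopE rnormZ ler_wpM2r ?rnorm_ge0//.
by apply/ltW/Kf => /KG.
Qed.

Lemma mulop_chi_comm (f : Cb X) G : mulop f * chi bg G = chi bg G * mulop f :> bop.
Proof.
apply: bopP => v; apply: lpE => x; rewrite !bopME mulopE !chiE mulopE.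
by case: ifP; rewrite ?scaler0.
Qed.

Lemma tight_cutdown (f g : Cb X) (c : bop) :
  C0 f -> C0 g -> tight bg (mulop f * c * mulop g).
Proof.
move=> f0 g0 eta e0; set Mf : bop := mulop f; set Mg : bop := mulop g.
pose M : R := opnorm (c * Mg) + opnorm (Mf * c) + 1.
have M0 : 0 < M by rewrite ltr_wpDl ?addr_ge0 ?opnorm_ge0.
have eM : 0 < eta / M by rewrite divr_gt0.
have [F Ffin Ff] := C0_tail f0 eM; have [G Gfin Gg] := C0_tail g0 eM.
have bound t : 0 <= t -> t <= M -> t * (eta / M) <= eta.
  by move=> t0 tM; rewrite mulrCA ger_pMr// ler_pdivrMr// mul1r.
exists (F `|` G); first by rewrite finite_setU.
split.
  have -> : Mf * c * Mg - chi bg (F `|` G) * (Mf * c * Mg) =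
      (Mf - chi bg (F `|` G) * Mf) * (c * Mg) by rewrite mulrBl !mulrA.
  apply: le_trans (opnormM _ _) _; rewrite mulrC.
  apply: le_trans (bound (opnorm (c * Mg)) _ _); rewrite ?opnorm_ge0//.
    by apply: ler_wpM2l (Ff _ (@subsetUl _ F G)); exact: opnorm_ge0.
  by rewrite /M -addrA lerDl addr_ge0 ?opnorm_ge0.
have -> : Mf * c * Mg - Mf * c * Mg * chi bg (F `|` G) =
    Mf * c * (Mg - chi bg (F `|` G) * Mg) by rewrite mulrBr -mulop_chi_comm !mulrA.
apply: le_trans (opnormM _ _) _.
apply: le_trans (bound (opnorm (Mf * c)) _ _); rewrite ?opnorm_ge0//.
  by apply: ler_wpM2l (Gg _ (@subsetUr _ F G)); exact: opnorm_ge0.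
by rewrite /M addrAC lerDr addr_ge0 ?opnorm_ge0.
Qed.

Lemma tight_Kom (B : set bop) k : Kom B k -> tight bg k.
Proof.
move=> /closure_opnormP kB eta e0; have e3 : 0 < eta / 3 by rewrite divr_gt0.
have [_ [f [c [g [f0 _ g0 ->]]]]] := kB _ e3.
set k0 := mulop f * c * mulop g => kk0.
have [F Ffin [Fl Fr]] := tight_cutdown c f0 g0 e3.
have opnormD s t : opnorm (s + t) <= opnorm s + opnorm t by exact: (rnormD s t).
have kk0' : opnorm (k0 - k) < eta / 3.
  by rewrite -opprB; move: kk0; rewrite -!bop_rnormE rnormN.
have sum3 (x y z : R) : x <= eta / 3 -> y <= eta / 3 -> z <= eta / 3 ->
  x + (y + z) <= eta by lra.
have small s t : opnorm s <= opnorm (k0 - k) -> opnorm t <= eta / 3 ->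
    opnorm (k - k0 + (t + s)) <= eta.
  move=> sk tk; apply: le_trans (opnormD _ _) _.
  apply: (le_trans _ (sum3 _ _ _ (ltW kk0) tk (le_trans sk (ltW kk0')))).
  by rewrite lerD2l; exact: opnormD.
exists F => //; split.
- have -> : k - chi bg F * k =
      k - k0 + (k0 - chi bg F * k0 + chi bg F * (k0 - k)).
    by rewrite mulrBr !addrA !subrK.
  apply: small => //.
  apply: le_trans (opnormM _ _) _; rewrite -[leRHS]mul1r.
  by apply: ler_wpM2r; [exact: opnorm_ge0|exact: opnorm_chi].
- have -> : k - k * chi bg F =
      k - k0 + (k0 - k0 * chi bg F + (k0 - k) * chi bg F).
    by rewrite mulrBl !addrA !subrK.
  apply: small => //.
  apply: le_trans (opnormM _ _) _; rewrite -[leRHS]mulr1.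
  by apply: ler_wpM2l; [exact: opnorm_ge0|exact: opnorm_chi].
Qed.

End FredholmInverse.

(** * Approximation for p = 0, 1 and infinity *)

Section Tents.
Context {R : realType} {X : metricType R}.

Definition tent (S : R) (z x : X) : R := Num.max 0 (1 - mdist z x / S).

Lemma tent01 S z x : 0 < S -> 0 <= tent S z x <= 1.
Proof.
move=> S0; rewrite le_max lexx/= ge_max ler01/= gerBl.
by rewrite divr_ge0 ?mdist_ge0 ?ltW.
Qed.

Lemma tent_center S z : tent S z z = 1.
Proof. by rewrite /tent mdistxx mul0r subr0 max_r. Qed.

Lemma tent_supp S z x : 0 < S -> S < mdist z x -> tent S z x = 0.
Proof.
by move=> S0 zx; rewrite /tent max_l// subr_le0 ler_pdivlMr// mul1r ltW.
Qed.

Lemma tent_lip S z x y : 0 < S -> `|tent S z x - tent S z y| <= mdist x y / S.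
Proof.
move=> S0; wlog xy : x y / tent S z y <= tent S z x => [H|].
  have [/H//|/ltW/H] := leP (tent S z y) (tent S z x).
  by rewrite distrC metric_sym.
rewrite ger0_norm ?subr_ge0// /tent lerBlDr ge_max; apply/andP; split.
  by rewrite addr_ge0 ?divr_ge0 ?mdist_ge0 ?(ltW S0)// le_max lexx.
apply: (@le_trans _ _ (mdist x y / S + (1 - mdist z y / S))); last first.
  by rewrite lerD2l le_max lexx orbT.
rewrite addrCA lerD2l lerNl opprB -mulrBl ler_pM2r ?invr_gt0//.
by rewrite lerBlDr; exact: metric_triangle.
Qed.

End Tents.

Section Approximation.
Context {R : realType} {X : metricType R} {E : normedModType R[i]}.
Context (bg : bounded_geometry X).

Lemma fam_le_supP (p : exponent R) (I : choiceType) (u : I -> R) c :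
  p = exp_c0 \/ p = exp_infty -> fam_le p u c <-> forall i, u i <= c.
Proof. by case=> ->. Qed.

Lemma fam_le_unitP (p : exponent R) (u : unit -> R) c : 0 <= u tt -> 0 <= c ->
  fam_le p u c <-> u tt <= c.
Proof.
move=> u0 c0; rewrite /fam_le; case: p => [|q q1|].
- by split=> [|? []].
- rewrite (esum_delta (i0 := tt)); last by case.
    rewrite lee_fin; split; first exact: powR_le_cancel.
    exact: ge0_powR_le.
  by move=> i; rewrite lee_fin powR_ge0.
- by split=> [|? []].
Qed.

Lemma delta01 (x z : X) : 0 <= ((x == z)%:R : R) <= 1.
Proof. exact: bool01. Qed.

Lemma delta_supp (S : R) (z x : X) : 0 <= S -> S < mdist z x -> (x == z)%:R = 0 :> R.
Proof.
by move=> S0; case: eqP => // ->; rewrite mdistxx ltNge S0.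
Qed.

Lemma sum_cball_delta (V : lmodType R[i]) (S : R) (F : X -> V) (x w : X) :
  (forall z, z != w -> F z = 0) ->
  \sum_(z <- fset_set (cball x S)) F z = if mdist x w <= S then F w else 0.
Proof.
move=> F0; have inb z : (z \in fset_set (cball x S)) = (mdist x z <= S).
  rewrite in_fset_set; last exact: finite_cball.
  by apply/idP/idP => [/set_mem //|h]; apply/mem_set.
case: ifPn => xw; last first.
  rewrite big_seq big1// => z; rewrite inb => xz; apply: F0.
  by apply: contra xw => /eqP <-.
by rewrite (bigD1_seq w) ?fset_uniq ?inb//= big1 ?addr0.
Qed.

Section Subalgebra.
Context (p : exponent R).
Local Notation lp := (lp X E p).
Local Notation bop := (bop lp).
Context (B : set bop).
Context (Balg : banach_subalgebra B).
Context (Bmul : cutdowns [set: Cb X] B [set: Cb X] = B).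
Context (Bblock : closed_under_block_cutdowns B).

(** The approximant has the row of b phi_x at x, where phi_x is a tent centred at
    x. Since phi_x(x) = 1, subtracting it from the row of b leaves the row of a
    commutator, whose norm is bounded independently of x. *)
Lemma approx_sup b eps : p = exp_c0 \/ p = exp_infty ->
  B b -> vanishing (comm bg b) -> 0 < eps ->
  exists2 b', (B `&` finite_propagation) b' & opnorm (b - b') <= eps.
Proof.
move=> psup Bb bv e0; have [r [d [d0 bd]]] := bv _ e0.
(* tents of width [S] vary by at most [d] over distances at most [r] *)
pose S := (`|r| + 1) / d; have S0 : 0 < S by rewrite divr_gt0 ?ltr_wpDl.
have phiv : small_variation (p := p) r d (tent S : X -> X -> R).
  split=> [z x|x|x y xy]; first exact: tent01.
    by apply/(fam_le_supP _ _ psup) => z; case/andP: (tent01 z x S0).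
  apply/(fam_le_supP _ _ psup) => z; apply: le_trans (tent_lip _ _ _ S0) _.
  rewrite ler_pdivrMr// /S mulrC divfK ?gt_eqF//.
  by rewrite (le_trans xy)// (le_trans (ler_norm r))// lerDl.
have [b' [Bb' b'f b'E]] := band_operator bg Balg Bmul Bblock (ltW S0) Bb
  (fun z x => delta01 x z) (fun z x => tent01 z x S0)
  (fun z x => @delta_supp _ z x (ltW S0)) (fun z x => @tent_supp _ _ _ z x S0).
exists b' => //; apply: opnorm_le => [|v]; first exact: ltW.
apply/lp_normP; first by rewrite mulr_ge0 ?rnorm_ge0 ?ltW.
apply/(fam_le_supP _ _ psup) => x.
have -> : (b - b') v x = comm bg b (tent S x) v x.
  rewrite -[LHS]/(b v x - b' v x) b'E (@sum_cball_delta _ _ _ _ x).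
    rewrite mdistxx (ltW S0) eqxx scale1r.
    rewrite -[RHS]/(mulr_op bg (tent S x) (b v) x - b (mulr_op bg (tent S x) v) x).
    by rewrite mulr_opE ?tent01// tent_center scale1r.
  by move=> z; rewrite eq_sym => /negbTE ->; rewrite scale0r.
apply: le_trans (rnorm_le_lp x (lpP _)) _.
exact: ((fam_le_supP _ _ psup).1 (bd _ _ phiv v) x).
Qed.

End Subalgebra.

Section FiniteExponent.
Context (q : R) (q1 : 1 <= q).
Local Notation lp := (lp X E (exp_fin q1)).
Local Notation bop := (bop lp).
Context (B : set bop).
Context (Balg : banach_subalgebra B).
Context (Bmul : cutdowns [set: Cb X] B [set: Cb X] = B).
Context (Bblock : closed_under_block_cutdowns B).
Implicit Types (v w : lp) (b t : bop).

Lemma fam_le_l1 (I : choiceType) (u : I -> R) c (K : set I) : q = 1 ->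
  (forall i, 0 <= u i) -> 0 <= c -> fam_le (exp_fin q1) u c -> finite_set K ->
  \sum_(i <- fset_set K) u i <= c.
Proof.
move=> qE u0 c0; rewrite /fam_le qE powRr1// => uc Kfin.
rewrite -lee_fin; apply: le_trans uc; apply: esum_ge; exists K => //.
rewrite fsbig_finite//= sumEFin lee_fin; apply: ler_sum => i _.
by rewrite powRr1.
Qed.

(** On l^1 the norm of an operator is the supremum of the norms of its columns. *)
Lemma opnorm_l1 t c : q = 1 -> 0 <= c ->
  (forall z v, rnorm (t (chi bg [set z] v)) <= c * rnorm (chi bg [set z] v)) ->
  opnorm t <= c.
Proof.
move=> qE c0 tc; apply: opnorm_le => // v; apply/ler_addgt0Pr => e e0.
have t1 : 0 < opnorm t + 1 by rewrite ltr_wpDl ?opnorm_ge0.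
have [//|K Kfin Kv] := finite_support_approx bg v _ (divr_gt0 e0 t1).
have vE : v = v - chi bg K v + chi bg K v by rewrite subrK.
rewrite {1}vE linearD addrC; apply: le_trans (rnormD _ _) _; apply: lerD; last first.
  apply: le_trans (rnorm_opnorm _ _) _.
  apply: le_trans (ler_wpM2l (opnorm_ge0 t) Kv) _.
  by rewrite mulrCA ger_pMr// ler_pdivrMr// mul1r lerDl.
have -> : chi bg K v = \sum_(z <- fset_set K) chi bg [set z] v.
  apply: lpE => x; rewrite lp_sumE chiE.
  under eq_bigr do rewrite chiE.
  have [xK|xK] := boolP (x \in K).
    rewrite (bigD1_seq x) ?fset_uniq ?in_fset_set//= mem_set// big1 ?addr0// => z zx.
    by rewrite memNset// => xz; rewrite xz eqxx in zx.
  rewrite big_seq big1// => z; rewrite in_fset_set// => zK.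
  rewrite memNset// => xz; by move: xK; rewrite xz zK.
rewrite linear_sum; apply: le_trans (rnorm_sum _ _ _) _.
apply: (@le_trans _ _ (c * \sum_(z <- fset_set K) rnorm (chi bg [set z] v))).
  by rewrite mulr_sumr; apply: ler_sum => z _; exact: tc.
apply: ler_wpM2l => //.
have cellE (z : X) : [set z] = cell (fun x => Some x) z.
  by apply/seteqP; split => x; rewrite /cell/=; [move=> ->|case].
under eq_bigr do rewrite cellE.
apply: (fam_le_l1 qE _ _ (fam_le_cells bg (fun x : X => Some x) v)) => // [z|];
  exact: rnorm_ge0.
Qed.

(** On a function supported at z, multiplying by the tent centred at z does
    nothing, so there b - b' is the commutator of [b] with that tent, up to sign.
    Families indexed by a point are enough here. *)
Lemma approx_l1 b eps : q = 1 ->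
  B b -> vanishing (comm bg b) -> 0 < eps ->
  exists2 b', (B `&` finite_propagation) b' & opnorm (b - b') <= eps.
Proof.
move=> qE Bb bv e0; have [r [d [d0 bd]]] := bv _ e0.
pose S := (`|r| + 1) / d; have S0 : 0 < S by rewrite divr_gt0 ?ltr_wpDl.
have phiv z : small_variation (p := exp_fin q1) r d
    ((fun _ : unit => tent S z) : unit -> X -> R).
  split=> [_ x|x|x y xy]; first exact: tent01.
    by apply/fam_le_unitP => //; case/andP: (tent01 z x S0).
  apply/fam_le_unitP => //; first exact: ltW.
  apply: le_trans (tent_lip _ _ _ S0) _.
  rewrite ler_pdivrMr// /S mulrC divfK ?gt_eqF//.
  by rewrite (le_trans xy)// (le_trans (ler_norm r))// lerDl.
have [b' [Bb' b'f b'E]] := band_operator bg Balg Bmul Bblock (ltW S0) Bb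
  (fun z x => tent01 z x S0) (fun z x => delta01 x z)
  (fun z x => @tent_supp _ _ _ z x S0) (fun z x => @delta_supp _ z x (ltW S0)).
exists b' => //; apply: opnorm_l1 => // [|z v]; first exact: ltW.
set w := chi bg [set z] v.
have chiw y : chi bg [set y] w = if y == z then w else 0.
  apply: lpE => x; rewrite /w !chiE.
  have [->|yz] := eqVneq y z; first by case: ifPn; rewrite ?chiE// => /negbTE ->.
  case: ifPn => // /set_mem ->; rewrite memNset// => /eqP; exact/negP.
have deltaE y : mulr_op bg (fun x => (x == y)%:R) w = chi bg [set y] w.
  apply: lpE => x; rewrite mulr_opE ?delta01// chiE.
  have -> : (x \in [set y]) = (x == y) by apply/idP/eqP => [/set_mem|->]; rewrite ?inE.
  by case: eqP; rewrite ?scale1r ?scale0r.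
have -> : (b - b') w = - comm bg b (tent S z) w.
  apply: lpE => x; rewrite -[LHS]/(b w x - b' w x) b'E (@sum_cball_delta _ _ _ _ z).
    rewrite deltaE chiw eqxx.
    rewrite -[RHS]/(- (mulr_op bg (tent S z) (b w) x - b (mulr_op bg (tent S z) w) x)).
    rewrite opprB mulr_opE ?tent01//; congr (_ - _).
      congr (b _ _); apply: lpE => y; rewrite mulr_opE ?tent01// /w chiE.
      by case: ifPn => [/set_mem ->|_]; rewrite ?tent_center ?scale1r ?scaler0.
    case: ifPn => //; rewrite -ltNge metric_sym => /(tent_supp S0) ->.
    by rewrite scale0r.
  by move=> y yz; rewrite deltaE chiw (negbTE yz) linear0 scaler0.
rewrite rnormN; have /fam_le_unitP := bd _ _ (phiv z) w; apply.
  exact: rnorm_ge0.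
by rewrite mulr_ge0 ?rnorm_ge0 ?ltW.
Qed.

(** Hoelder's inequality up to the factor 2, by an elementary argument. Compare
    each [u] with U f^(1/q): if it is smaller, the term is at most U f; otherwise
    it is at most u^q / U^(q - 1). Both sum to at most U. *)
Lemma sum_le_lq (I : eqType) (s : seq I) (f u : I -> R) (U : R) :
  1 < q -> (forall i, 0 <= f i) -> (forall i, 0 <= u i) -> 0 <= U ->
  \sum_(i <- s) f i <= 1 -> \sum_(i <- s) u i `^ q <= U `^ q ->
  \sum_(i <- s) f i `^ (1 - q^-1) * u i <= 2 * U.
Proof.
move=> q1' f0 u0 U0 f1 uU; have q0 : 0 < q by exact: lt_trans q1'.
have [U00|Upos] := eqVneq U 0.
  rewrite U00 mulr0 big_seq big1// => i; elim: s uU {f1} => // j s IH.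
  rewrite U00 powR0 ?gt_eqF// big_cons inE => le0.
  have s0 : 0 <= \sum_(i <- s) u i `^ q by apply: sumr_ge0 => k _; exact: powR_ge0.
  have uj0 := powR_ge0 (u j) q.
  move=> /predU1P[->|]; last first.
    by apply: IH; rewrite U00 powR0 ?gt_eqF//; lra.
  have /eqP : u j `^ q = 0 by lra.
  by rewrite powR_eq0 => /andP[/eqP -> _]; rewrite mulr0.
have {}Upos : 0 < U by rewrite lt_neqAle eq_sym Upos.
have key i : f i `^ (1 - q^-1) * u i <= U * f i + u i `^ q / U `^ (q - 1).
  have r0 : 0 <= u i `^ q / U `^ (q - 1) by rewrite divr_ge0 ?powR_ge0.
  have Uf0 : 0 <= U * f i by rewrite mulr_ge0.
  have fE : f i = f i `^ q^-1 `^ q by rewrite -powRrM mulVf ?powRr1 ?gt_eqF.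
  have fE' : f i `^ (1 - q^-1) = f i `^ q^-1 `^ (q - 1).
    by rewrite -powRrM mulrBr mulr1 mulVf ?gt_eqF.
  rewrite fE'; set g := f i `^ q^-1 in fE *; have g0 : 0 <= g by exact: powR_ge0.
  have [ug|ug] := leP (u i) (U * g).
    apply: (@le_trans _ _ (U * f i)); last by rewrite lerDl.
    rewrite fE -(mulr_powRB1 g0 q0).
    apply: le_trans (ler_wpM2l (powR_ge0 _ _) ug) _.
    by rewrite mulrC -mulrA.
  apply: (@le_trans _ _ (u i `^ q / U `^ (q - 1))); last by rewrite lerDr.
  rewrite -(mulr_powRB1 (u0 i) q0) mulrC -mulrA; apply: ler_wpM2l => //.
  rewrite ler_pdivlMr ?powR_gt0// -powRM ?(ltW Upos)// mulrC.
  apply: ge0_ler_powR; rewrite ?nnegrE ?mulr_ge0 ?subr_ge0 ?(ltW Upos)//.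
  exact: ltW.
apply: le_trans (ler_sum _ (fun i _ => key i)) _.
rewrite big_split/= -mulr_sumr -mulr_suml mulrDl mul1r; apply: lerD.
  by rewrite ger_pMr.
by rewrite ler_pdivrMr ?powR_gt0// mulr_powRB1// ltW.
Qed.

End FiniteExponent.

End Approximation.

(** * Property A *)

Section PropertyA.
Context {R : realType} {X : metricType R}.
Local Open Scope ereal_scope.

(** Partitions of unity indexed by the points of [X], the function of index z being
    supported near z, with small variation in l^1. This form of Property A suits
    every exponent: f |-> f^(1/q) carries it to l^q. *)
Definition l1_partitions := forall r eps : R, (0 < eps)%R ->
  exists (S : R) (f : X -> X -> R),
  [/\ (0 <= S)%R, forall z x, (0 <= f z x)%R,
      forall z x, (S < mdist z x)%R -> f z x = 0%R,
      forall x, \esum_(z in [set: X]) (f z x)%:E = 1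
    & forall x y, (mdist x y <= r)%R ->
        \esum_(z in [set: X]) `|f z x - f z y|%:E <= eps%:E].

(** For w <= u, either w is at least (1 - kappa)^(1/s) u, and then w^s is at least
    (1 - kappa) u^s, or u is at most a constant times u - w. Summed over a
    partition of unity, this turns small variation in l^s into small variation of
    the s-th powers in l^1. *)
Lemma dist_powR_le (s kappa : R) : (1 <= s)%R -> (0 < kappa < 1)%R ->
  exists2 C : R, (0 < C)%R & forall u w : R, (0 <= u)%R -> (0 <= w)%R ->
    (`|u `^ s - w `^ s| <= kappa * (u `^ s + w `^ s) + C * `|u - w| `^ s)%R.
Proof.
move=> s1 /andP[k0 k1]; have s0 : (0 < s)%R by exact: lt_le_trans s1.
pose th := ((1 - kappa) `^ s^-1)%R.
have ths : (th `^ s = 1 - kappa)%R.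
  by rewrite -powRrM mulVf ?gt_eqF// powRr1// subr_ge0 ltW.
have th0 : (0 <= th)%R by exact: powR_ge0.
have th1 : (th < 1)%R.
  rewrite ltNge; apply/negP => /(ge0_powR_le s1 ler01).
  by rewrite powR1 ths; lra.
have T0 : (0 < (1 - th) `^ s)%R by rewrite powR_gt0 ?subr_gt0.
exists ((1 - th) `^ s)^-1%R; first by rewrite invr_gt0.
move=> u w; wlog wu : u w / (w <= u)%R => [H|].
  move=> u0 w0; have [wu|/ltW uw] := leP w u; first exact: H.
  by rewrite distrC [(u `^ s + _)%R]addrC -[(u - w)%R]opprB normrN; exact: H.
move=> u0 w0; have wus := ge0_powR_le s1 w0 wu.
rewrite ger0_norm ?subr_ge0// ger0_norm ?subr_ge0//.
have us := powR_ge0 u s; have ws := powR_ge0 w s.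
have uws := powR_ge0 (u - w) s.
have Cuw : (0 <= ((1 - th) `^ s)^-1 * (u - w) `^ s)%R.
  by rewrite mulr_ge0// invr_ge0 ltW.
have [tw|tw] := leP (th * u)%R w.
  have := ge0_powR_le s1 (mulr_ge0 th0 u0) tw.
  rewrite powRM// ths => h.
  have kw : (0 <= kappa * w `^ s)%R by rewrite mulr_ge0// ltW.
  by move: h; rewrite mulrBl mul1r mulrDr; lra.
have tu : ((1 - th) * u <= u - w)%R by rewrite mulrBl mul1r; lra.
have := ge0_powR_le s1 (mulr_ge0 _ u0) tu; rewrite subr_ge0 => /(_ (ltW th1)).
rewrite powRM ?subr_ge0 ?(ltW th1)// -ler_pdivlMl// => h.
have kuw : (0 <= kappa * (u `^ s + w `^ s))%R by rewrite mulr_ge0 ?addr_ge0// ltW.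
by lra.
Qed.

(** Raise the given partition to the power [s] of its exponent, and add up the
    functions whose supports have the same base point. *)
Lemma property_A_l1_partitions : X -> property_A X -> l1_partitions.
Proof.
move=> x0 [s s1 A] r eps e0; have s0 : (0 < s)%R by exact: lt_le_trans s1.
pose kappa := (Num.min (eps / 4) 2^-1)%R.
have kk : (0 < kappa < 1)%R.
  by rewrite lt_min divr_gt0//= invr_gt0 ltr0n/= gt_min; apply/orP; right; lra.
have [C C0 powC] := dist_powR_le s1 kk.
have eC : (0 < eps / (2 * C))%R by rewrite divr_gt0 ?mulr_gt0.
have [|I [phi [[phi01 phidiam _ phi1] phiv]]] :=
  A (Num.max r 1)%R ((eps / (2 * C)) `^ s^-1)%R _ (powR_gt0 _ eC).
  by rewrite lt_max ltr01 orbT.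
have phi0 i x : (0 <= phi i x)%R by have /andP[] := phi01 i x.
pose g i x := (phi i x `^ s)%R.
have g0 i x : (0 <= g i x)%R by exact: powR_ge0.
have gv x y : (mdist x y <= r)%R ->
    \esum_(i in [set: I]) `|g i x - g i y|%:E <= eps%:E.
  move=> xy.
  apply: (@le_trans _ _ (\esum_(i in [set: I])
    (kappa%:E * ((g i x)%:E + (g i y)%:E) + C%:E * (`|phi i x - phi i y| `^ s)%:E))).
    apply: le_esum => i _.
    by have := powC _ _ (phi0 i x) (phi0 i y); rewrite -lee_fin EFinD !EFinM EFinD.
  have k0 : (0 <= kappa)%R by case/andP: kk => /ltW.
  rewrite esumD; last 2 first.
  - by move=> i _; rewrite -EFinD -EFinM lee_fin mulr_ge0// addr_ge0.
  - by move=> i _; rewrite -EFinM lee_fin mulr_ge0 ?powR_ge0// ltW.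
  have -> : eps = (kappa * (1 + 1) + (eps - kappa * (1 + 1)))%R by ring.
  rewrite EFinD; apply: leeD.
    apply: le_trans (esumZ k0 _) _; first by move=> i; rewrite -EFinD lee_fin addr_ge0.
    by rewrite esumD ?phi1// => i _; rewrite lee_fin.
  apply: le_trans (esumZ (ltW C0) _) _; first by move=> i; rewrite lee_fin powR_ge0.
  have := phiv x y; rewrite le_max xy => /(_ isT)/ltW h.
  apply: le_trans (lee_wpmul2l _ h) _; first by rewrite lee_fin ltW.
  rewrite -EFinM lee_fin -powRrM mulVf ?gt_eqF// powRr1 ?(ltW eC)//.
  have : (kappa <= eps / 4)%R by rewrite ge_min lexx.
  have -> : (C * (eps / (2 * C)) = eps / 2)%R by field; rewrite gt_eqF.
  by lra.
have [S S0 SD] : exists2 S : R, (0 <= S)%R & forall i, diam (supp (phi i)) <= S%:E.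
  move: phidiam; set D := ereal_sup _ => Doo; exists (Num.max 0 (fine D))%R.
    by rewrite le_max lexx.
  move=> i; have : diam (supp (phi i)) <= D by apply: ereal_sup_ubound; exists i.
  move/le_trans; apply; case: D Doo => [d _|//|_]; last by rewrite leNye.
  by rewrite lee_fin le_max lexx orbT.
(* [c i] is a base point in the support of [phi i] *)
have /choice[c cP] : forall i, exists z, forall x,
    phi i x != 0%R -> (mdist z x <= S)%R.
  move=> i; have [[z zi]|nz] := pselect (exists z, phi i z != 0%R); last first.
    by exists x0 => x xi; case: nz; exists x.
  exists z => x xi; rewrite -lee_fin; apply: le_trans (SD i).
  apply: ereal_sup_ubound; exists z; first exact: subset_closure.
  by exists x => //; exact: subset_closure.
pose F z x := \esum_(i in [set: I]) (if c i == z then g i x else 0%R)%:E.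
have Fterm0 z x i : (0 <= (if c i == z then g i x else 0))%R by case: ifP.
have F0 z x : 0 <= F z x by apply: esum_ge0 => i _; rewrite lee_fin.
have F1 z x : F z x <= 1.
  by rewrite -(phi1 x); apply: le_esum => i _; rewrite lee_fin; case: ifP; rewrite ?powR_ge0.
have FE z x : F z x = (fine (F z x))%:E.
  by rewrite fineK// ge0_fin_numE// (le_lt_trans (F1 z x))// ltry.
exists S, (fun z x => fine (F z x)); split => //.
- by move=> z x; rewrite fine_ge0.
- move=> z x zx; rewrite /F esum1// => i _; case: eqP => // ci.
  rewrite /g; have [->|/cP] := eqVneq (phi i x) 0%R; first by rewrite powR0 ?gt_eqF.
  by rewrite ci leNgt zx.
- move=> x; under eq_esum do rewrite -FE.
  rewrite exchange_esum; last by move=> z i; rewrite lee_fin.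
  rewrite -(phi1 x); apply: eq_esum => i _.
  rewrite (esum_delta (i0 := c i)) ?eqxx// => [z|z zi]; first by rewrite lee_fin.
  by rewrite eq_sym (negbTE zi).
- move=> x y xy; apply: le_trans (gv x y xy).
  pose D z := \esum_(i in [set: I]) (if c i == z then `|g i x - g i y| else 0%R)%:E.
  have D0 i z : (0 <= (if c i == z then `|g i x - g i y| else 0))%R by case: ifP.
  have -> : \esum_(i in [set: I]) `|g i x - g i y|%:E = \esum_(z in [set: X]) D z.
    rewrite /D exchange_esum; last by move=> z i; rewrite lee_fin.
    apply: eq_esum => i _.
    rewrite (esum_delta (i0 := c i)) ?eqxx// => [z|z zi]; first by rewrite lee_fin.
    by rewrite eq_sym (negbTE zi).
  apply: le_esum => z _.
  have FD (x' y' : X) : (forall i, `|g i x' - g i y'| = `|g i x - g i y|)%R ->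
      F z x' <= F z y' + D z.
    move=> xy'; rewrite /F /D -esumD => [|i _|i _]; rewrite ?lee_fin//.
    apply: le_esum => i _; rewrite -EFinD lee_fin -xy'; case: ifP; rewrite ?addr0// => _.
    by rewrite -lerBlDl ler_norm.
  have := FD x y (fun=> erefl); have := FD y x (fun=> distrC _ _).
  rewrite [F z x]FE [F z y]FE /=.
  case: (D z) => [d|_ _|]; last 2 first.
  + by rewrite leey.
  + by rewrite !addeNy// leeNy_eq.
  rewrite -!EFinD !lee_fin ler_norml => h1 h2; apply/andP; split; lra.
Qed.

End PropertyA.

(** * Approximation for 1 < p < oo *)

Section ReflexiveRange.
Context {R : realType} {X : metricType R} {E : normedModType R[i]}.
Context (bg : bounded_geometry X).
Context (q : R) (q1 : 1 <= q).
Local Notation lp := (lp X E (exp_fin q1)).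
Local Notation bop := (bop lp).
Context (B : set bop).
Context (Balg : banach_subalgebra B).
Context (Bmul : cutdowns [set: Cb X] B [set: Cb X] = B).
Context (Bblock : closed_under_block_cutdowns B).
Implicit Types (v w : lp) (b t : bop).

(** As sum_z psi_z phi_z = 1, the difference b - b' is the sum over z of
    psi_z (phi_z b - b phi_z). At each point [sum_le_lq] bounds it by the l^q norm
    over z of the commutators, and summing over the points gives their column
    norm. *)
Lemma approx_lq b eps : 1 < q -> l1_partitions (X := X) ->
  B b -> vanishing (comm bg b) -> 0 < eps ->
  exists2 b', (B `&` finite_propagation) b' & opnorm (b - b') <= 2 * eps.
Proof.
move=> q1' A Bb bv e0; have [r [d [d0 bd]]] := bv _ e0.
have q0 : 0 < q by exact: lt_trans q1'.
have qV0 : 0 < q^-1 by rewrite invr_gt0.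
have qV1 : 0 < 1 - q^-1 by rewrite subr_gt0 invf_lt1.
have [S [f [S0 f0 fS f1 fv]]] := A r (d `^ q) (powR_gt0 _ d0).
have f_le1 z x : f z x <= 1.
  by rewrite -lee_fin -(f1 x) (le_esum_coord z)// => y; rewrite lee_fin.
have pow01 c z x : 0 < c -> 0 <= f z x `^ c <= 1.
  move=> c0; rewrite powR_ge0/=.
  have -> : 1 = 1 `^ c :> R by rewrite powR1.
  by apply: ge0_ler_powR; rewrite ?nnegrE ?(ltW c0).
have powS c z x : 0 < c -> S < mdist z x -> f z x `^ c = 0.
  by move=> c0 /fS ->; rewrite powR0 ?gt_eqF.
pose phi z x := f z x `^ q^-1; pose psi z x := f z x `^ (1 - q^-1).
have phiq z x : phi z x `^ q = f z x by rewrite /phi -powRrM mulVf ?gt_eqF// powRr1.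
have phi0 z x : 0 <= phi z x by exact: powR_ge0.
have phiv : small_variation (p := exp_fin q1) r d phi.
  split=> [z x|x|x y xy]; first exact: pow01.
    by rewrite /fam_le powR1 -(f1 x); apply: le_esum => z _; rewrite phiq.
  apply: le_trans (fv x y xy); apply: le_esum => z _; rewrite lee_fin.
  rewrite -!phiq; move: (phi z x) (phi z y) (phi0 z x) (phi0 z y) => {z}.
  move=> s t; wlog ts : s t / t <= s => [H s0 t0|s0 t0].
    have [ts|/ltW st] := leP t s; first exact: H.
    by rewrite distrC [leRHS]distrC; exact: H.
  rewrite ger0_norm ?subr_ge0// ger0_norm ?subr_ge0 ?ge0_powR_le//.
  have st0 : 0 <= s - t by rewrite subr_ge0.
  by have := powRD_ge q1 t0 st0; rewrite [t + _]addrC subrK lerBrDl.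
have [b' [Bb' b'f b'E]] := band_operator bg Balg Bmul Bblock S0 Bb
  (fun z x => pow01 _ z x qV1) (fun z x => pow01 _ z x qV0)
  (fun z x => powS _ z x qV1) (fun z x => powS _ z x qV0).
exists b' => //; apply: opnorm_le => [|v]; first by rewrite mulr_ge0// ltW.
pose u z x := rnorm (comm bg b (phi z) v x).
have sum_f x : \sum_(z <- fset_set (cball x S)) f z x = 1.
  have fin := finite_cball bg x S.
  apply: EFin_inj; rewrite -(f1 x) -sumEFin -fsbig_finite// -esum_fset//.
    rewrite esum_mkcond; apply: eq_esum => z _; case: ifPn => //.
    by rewrite notin_setE /cball/= metric_sym => /negP; rewrite -ltNge => /fS ->.
  by move=> z _; rewrite lee_fin.
have diffE x : (b - b') v x =
    \sum_(z <- fset_set (cball x S)) (psi z x)%:C *: comm bg b (phi z) v x.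
  have termE z : (psi z x)%:C *: comm bg b (phi z) v x =
      (f z x)%:C *: b v x - (psi z x)%:C *: b (mulr_op bg (phi z) v) x.
    rewrite -[comm _ _ _ _ _]/(mulr_op bg (phi z) (b v) x -
      b (mulr_op bg (phi z) v) x).
    rewrite mulr_opE ?pow01// scalerBr scalerA -rmorphM /=; congr (_%:C *: _ - _).
    have := @powRD _ (f z x) (1 - q^-1) q^-1; rewrite subrK oner_eq0 => /(_ isT).
    by rewrite powRr1.
  under eq_bigr do rewrite termE.
  rewrite sumrB -scaler_suml -rmorph_sum /= sum_f scale1r.
  by rewrite -[LHS]/(b v x - b' v x) b'E.
have pointwise x : rnorm ((b - b') v x) `^ q <=
    2 `^ q * \sum_(z <- fset_set (cball x S)) u z x `^ q.
  set U := \sum_(z <- _) _.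
  have U0 : 0 <= U by apply: sumr_ge0 => z _; exact: powR_ge0.
  have UE : (U `^ q^-1) `^ q = U by rewrite -powRrM mulVf ?gt_eqF// powRr1.
  rewrite -UE -powRM ?powR_ge0//; apply: ge0_powR_le => //; first exact: rnorm_ge0.
  rewrite diffE; apply: le_trans (rnorm_sum _ _ _) _.
  under eq_bigr do rewrite rnormZr ger0_norm ?powR_ge0//.
  apply: sum_le_lq => //; rewrite ?powR_ge0 ?sum_f ?UE//.
  by move=> z; exact: rnorm_ge0.
apply/lp_normP; first by rewrite !mulr_ge0 ?rnorm_ge0// ltW.
rewrite /fam_le -mulrA powRM ?mulr_ge0 ?rnorm_ge0 ?(ltW e0)// EFinM.
have := bd _ _ phiv v; rewrite /fam_le.
under eq_esum do rewrite -esum_lp.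
rewrite exchange_esum; last by move=> z x; rewrite lee_fin powR_ge0.
move=> /(lee_wpmul2l (_ : (0 <= (2 `^ q)%:E)%E)); rewrite lee_fin powR_ge0.
move=> /(_ isT); apply: le_trans.
apply: le_trans (esumZ _ _); rewrite ?powR_ge0//; last first.
  by move=> x; apply: esum_ge0 => z _; rewrite lee_fin powR_ge0.
apply: le_esum => x _; apply: (@le_trans _ _ (2 `^ q *
    \sum_(z <- fset_set (cball x S)) u z x `^ q)%:E).
  by rewrite lee_fin; exact: pointwise.
rewrite EFinM; apply: lee_wpmul2l; first by rewrite lee_fin powR_ge0.
apply: esum_ge; exists (cball x S); first by split=> //; exact: finite_cball.
by rewrite fsbig_finite ?sumEFin//; exact: finite_cball.
Qed.

End ReflexiveRange.

(** * The theorem *)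

Section RoeMembership.
Context {R : realType} {X : metricType R} {E : normedModType R[i]}
  {p : exponent R}.
Context (bg : bounded_geometry X).
Local Notation lp := (lp X E p).
Local Notation bop := (bop lp).
Context (B : set bop).
Context (Balg : banach_subalgebra B).
Context (Bmul : cutdowns [set: Cb X] B [set: Cb X] = B).
Context (Bblock : closed_under_block_cutdowns B).

Lemma Roe_of_vanishing b : ((1 < p < +oo)%E -> l1_partitions (X := X)) ->
  B b -> vanishing (comm bg b) -> Roe B b.
Proof.
move=> A Bb bv; apply/closure_opnormP => eps e0.
have e4 : 0 < eps / 4 by rewrite divr_gt0.
suff [b' b'B b'e] : exists2 b', (B `&` finite_propagation) b' &
    opnorm (b - b') <= 2 * (eps / 4).
  by exists b' => //; apply: le_lt_trans b'e _; lra.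
have e4' : eps / 4 <= 2 * (eps / 4) by lra.
case: p B Balg Bmul Bblock b A Bb bv => [|q q1|] B' Balg' Bmul' Bblock' b A Bb bv.
- have [|b' ? h] := approx_sup Balg' Bmul' Bblock' _ Bb bv e4; first by left.
  by exists b' => //; exact: le_trans h e4'.
- have [qE|qN1] := eqVneq q 1.
    have [b' ? h] := approx_l1 Balg' Bmul' Bblock' qE Bb bv e4.
    by exists b' => //; exact: le_trans h e4'.
  have q1' : 1 < q by rewrite lt_neqAle eq_sym qN1.
  apply: approx_lq => //; apply: A.
  by rewrite /= lte_fin q1' ltry.
- have [|b' ? h] := approx_sup Balg' Bmul' Bblock' _ Bb bv e4; first by right.
  by exists b' => //; exact: le_trans h e4'.
Qed.

End RoeMembership.

Theorem proposition6p4 (R : realType) (X : metricType R)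
    (E : completeNormedModType R[i]) (p : exponent R)
    (B : set (bop (lp X E p))) :
  bounded_geometry X ->
  ((1 < p < +oo)%E -> property_A X) ->
  banach_subalgebra B ->
  cutdowns [set: Cb X] B [set: Cb X] = B ->
  closed_under_block_cutdowns B ->
  (forall a, Roe B a -> forall b, B b ->
     Kom B (1 - a * b) -> Kom B (1 - b * a) -> Roe B b)
  /\ (inverse_closed B -> inverse_closed (Roe B)).
Proof.
move=> bg A Balg Bmul Bblock.
have [B0 _ _ _ Bclosed] := Balg.
have Fredholm a : Roe B a -> forall b, B b ->
    Kom B (1 - a * b) -> Kom B (1 - b * a) -> Roe B b.
  move=> Ra b Bb Kab Kba.
  have [[x0 _]|X0] := pselect ([set: X] !=set0); last first.
    apply: subset_closure; split=> //.
    have -> : b = 0; last by exists 0 => // f f' _; rewrite mulr0 mul0r.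
    by apply: bopP => v; apply: lpE => x; case: X0; exists x.
  apply: (Roe_of_vanishing Balg Bmul Bblock (bg := bg)) => //.
    by move=> /A; apply: property_A_l1_partitions.
  apply: (@vanishing_comm_inverse _ _ _ _ bg a b x0).
  - by apply: closureS Ra => t [].
  - exact: tight_Kom Kab.
  - exact: tight_Kom Kba.
split; first exact: Fredholm.
move=> Binv a a' Ra aa' a'a.
have Kom0 : Kom B 0.
  apply: subset_closure; exists (cb bg (fun=> 0)), 0, (cb bg (fun=> 0)).
  have C00 : C0 (cb bg (fun=> 0)).
    move=> eps e0; exists set0 => [|x _]; first exact: compact0.
    by rewrite cbE ?lexx ?ler01// rnorm0.
  by split=> //; rewrite mulr0 mul0r.
have Ba : B a by apply: Bclosed; apply: closureS Ra => t [].
by apply: (Fredholm a Ra a'); [exact: Binv aa' a'a|rewrite aa' subrr|rewrite a'a subrr].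
Qed.
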